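(* (Singular neck-cutting relation.) Let $F$ be a closed $GL(2)$ foam containing a portion consisting of a thin vertical tube $\mathbb{S}^1\times[0,1]$ with a single singular circle $\mathbb{S}^1\times\{1/2\}$ in it, along which a double facet that is a horizontal disk filling the circle inside the tube is attached. Assume the singular circle is oriented so that it is positive in every coloring of $F$ in which the thin facet above the circle (the top facet) is colored $1$. Remove the double disk and the open tube from $F$ and glue two parallel thin disks to the circles $\mathbb{S}^1\times\{1\}$ and $\mathbb{S}^1\times\{0\}$, extending the upper and the lower thin facet respectively. Let $F_1$ be the resulting foam with an additional dot on the top disk, and $F_2$ the resulting foam with an additional dot on the bottom disk. Then $$\langle F\rangle=\langle F_2\rangle-\langle F_1\rangle.$$
   Context: $\mathbf{k}=\mathbb{Z}[\beta_{k,\ell}:k,\ell\ge0,(k,\ell)\ne(0,0)]$; $p(x,y)=1+\sum\beta_{k,\ell}x^ky^\ell$; $p_{12}=p(x_1,x_2)$, $p_{21}=p(x_2,x_1)$. A closed $GL(2)$ foam $F$ is a compact two-dimensional combinatorial CW-complex embedded in $\mathbb{R}^3$ whose only singularities are singular circles, with neighbourhood $\mathbb{S}^1\times$tripod; facets are thin or double, and along each singular circle two thin facets and one double facet meet. Facets are oriented so that at each singular circle the orientation of each adjacent thin facet agrees with that of the double facet across the circle; the circle is oriented by $t$, where $(v,t)$ is an oriented basis coming from a thin facet with $v$ pointing into the double facet. Thin facets may carry dots. A coloring $c$ maps thin facets to $\{1,2\}$ so that the two thin facets at each singular circle have different colors; double facets are colored $\{1,2\}$. $F_i(c)$ is the union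 of closed facets whose color is or contains $i$; $\chi_i(c)=\chi(F_i(c))$; $F_{12}$ is the union of thin facets; $d_i(c)$ is the number of dots on facets colored $i$; $\theta^+(c)$ is the number of positive singular circles, where a circle is positive if, looking in the direction of its orientation, the first thin facet met counterclockwise starting from the double facet is colored $1$. Evaluation: $\langle F\rangle=\sum_c\langle F,c\rangle$ over all colorings, with $$\langle F,c\rangle=(-1)^{\theta^+(c)+\chi_2(c)/2}\,\frac{x_1^{d_1(c)}x_2^{d_2(c)}p_{12}^{\chi_1(c)/2}p_{21}^{\chi_2(c)/2}}{(x_1-x_2)^{\chi(F_{12})/2}}\in\mathbf{k}\llbracket x_1,x_2\rrbracket\Bigl[\tfrac1{x_1-x_2}\Bigr].$$ *)

(* Defs.v *)
From HB Require Import structures.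
From mathcomp Require Import all_boot all_order all_algebra.
From mathcomp.multinomials Require Import monalg.
From mathcomp Require Import boolp classical_sets reals topology normedtype.
From mathcomp Require Import fintype finset generic_quotient ring.
Import Order.TTheory GRing.Theory Num.Theory numFieldNormedType.Exports.

Set Implicit Arguments.
Unset Strict Implicit.
Unset Printing Implicit Defensive.

Local Open Scope quotient_scope.
Local Open Scope ring_scope.

Section PowerSeries.
Variable R : comNzRingType.

(* Formal power series in one variable. *)
Record fps := Fps { fps_coef : nat -> R }.

Lemma fpsP (f g : fps) : (forall n, fps_coef f n = fps_coef g n) -> f = g.
Proof. by case: f g => f [g] /= fg; congr Fps; apply/funext. Qed.

HB.instance Definition _ := gen_eqMixin fps.
HB.instance Definition _ := gen_choiceMixin fps.

Definition fps_zero := Fps (fun=> 0).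
Definition fps_opp f := Fps (fun n => - fps_coef f n).
Definition fps_add f g := Fps (fun n => fps_coef f n + fps_coef g n).
Definition fps_const (c : R) := Fps (fun n => if n == 0%N then c else 0).
Definition fps_var := Fps (fun n => (n == 1%N)%:R).
Definition fps_mul f g :=
  Fps (fun n => \sum_(i < n.+1) fps_coef f i * fps_coef g (n - i)%N).

Lemma fps_addA : associative fps_add.
Proof. by move=> f g h; apply: fpsP => n; apply: addrA. Qed.
Lemma fps_addC : commutative fps_add.
Proof. by move=> f g; apply: fpsP => n; apply: addrC. Qed.
Lemma fps_add0 : left_id fps_zero fps_add.
Proof. by move=> f; apply: fpsP => n; apply: add0r. Qed.
Lemma fps_addN : left_inverse fps_zero fps_opp fps_add.
Proof. by move=> f; apply: fpsP => n; apply: addNr. Qed.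
HB.instance Definition _ :=
  GRing.isZmodule.Build fps fps_addA fps_addC fps_add0 fps_addN.

Let trunc N f : {poly R} := \poly_(i < N.+1) fps_coef f i.

Let coef_trunc N f n : (n <= N)%N -> (trunc N f)`_n = fps_coef f n.
Proof. by move=> nN; rewrite coef_poly ltnS nN. Qed.

Let fps_mulE N f g n : (n <= N)%N ->
  fps_coef (fps_mul f g) n = (trunc N f * trunc N g)`_n.
Proof.
move=> nN; rewrite coefM; apply: eq_bigr => i _.
by rewrite !coef_trunc ?(leq_trans (leq_subr _ _)) // (leq_trans _ nN) // -ltnS.
Qed.

Lemma fps_mulC : commutative fps_mul.
Proof.
by move=> f g; apply: fpsP => n; rewrite !(fps_mulE _ _ (leqnn n)) mulrC.
Qed.

Lemma fps_mulA : associative fps_mul.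
Proof.
move=> f g h; apply: fpsP => n.
rewrite !(fps_mulE _ _ (leqnn n)).
transitivity ((trunc n f * (trunc n g * trunc n h))`_n).
  rewrite !coefM; apply: eq_bigr => i _; congr (_ * _).
  by rewrite coef_trunc ?leq_subr // (@fps_mulE n) ?leq_subr.
rewrite mulrA !coefM; apply: eq_bigr => i _; congr (_ * _).
have iN : (i <= n)%N by rewrite -ltnS.
by rewrite (coef_trunc _ iN) (fps_mulE _ _ iN).
Qed.

Lemma fps_mul1 : left_id (fps_const 1) fps_mul.
Proof.
move=> f; apply: fpsP => n /=.
rewrite big_ord_recl /= mul1r subn0 big1 ?addr0 // => i _.
by rewrite mul0r.
Qed.

Lemma fps_mulDl : left_distributive fps_mul fps_add.
Proof.
move=> f g h; apply: fpsP => n /=; rewrite -big_split /=.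
by apply: eq_bigr => i _; rewrite mulrDl.
Qed.

Lemma fps_one_neq0 : fps_const 1 != fps_zero.
Proof. by apply/eqP => -[/(congr1 (@^~ 0%N))] /= /eqP; rewrite oner_eq0. Qed.

HB.instance Definition _ := GRing.Zmodule_isComNzRing.Build fps
  fps_mulA fps_mulC fps_mul1 fps_mulDl fps_one_neq0.

Lemma fps_coefM (f g : fps) n :
  fps_coef (f * g) n = \sum_(i < n.+1) fps_coef f i * fps_coef g (n - i)%N.
Proof. by []. Qed.

Lemma fps_var_reg : GRing.lreg fps_var.
Proof.
move=> f g /(congr1 fps_coef) fg; apply: fpsP => n.
have coef_var (h : fps) : fps_coef (fps_var * h) n.+1 = fps_coef h n.
  rewrite fps_coefM 2!big_ord_recl /= mul0r add0r mul1r subSS subn0.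
  by rewrite big1 ?addr0 // => i _; rewrite mul0r.
by rewrite -!coef_var fg.
Qed.

Lemma fps_const_subvar_reg (c : R) :
  GRing.lreg c -> GRing.lreg (fps_const c - fps_var).
Proof.
move=> c_reg f g /eqP; rewrite -subr_eq0 -mulrBr => /eqP fg0.
apply/eqP; rewrite -subr_eq0; apply/eqP; move: (f - g) fg0 => h h0.
have coef_eq n : fps_coef ((fps_const c - fps_var) * h) n
   = c * fps_coef h n - (if n is m.+1 then fps_coef h m else 0).
  rewrite fps_coefM big_ord_recl /= subn0 subr0; congr (_ + _).
  case: n => [|n]; first by rewrite big_ord0 oppr0.
  rewrite big_ord_recl /= subSS subn0 sub0r mulN1r big1 ?addr0 // => i _.
  by rewrite subr0 mul0r.
apply: fpsP => n; rewrite /=.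
elim: n => [|n IHn].
  by have := coef_eq 0%N; rewrite h0 subr0 => /esym ch0; apply: c_reg; rewrite mulr0.
have := coef_eq n.+1; rewrite h0 IHn subr0 => /esym ch0.
by apply: c_reg; rewrite mulr0.
Qed.

End PowerSeries.

(* The localization R[1/a] at a regular element a. *)
Section Localization.
Variables (R : comNzRingType) (a : R).
Hypothesis a_reg : GRing.lreg a.

Let powa_reg n : GRing.lreg (a ^+ n).
Proof. exact: lregX. Qed.

(* The pair (f, m) stands for the fraction f / a ^ m. *)
Definition away_eq (u v : R * nat) := u.1 * a ^+ v.2 == v.1 * a ^+ u.2.

Lemma away_eq_refl : reflexive away_eq.
Proof. by move=> u; apply: eqxx. Qed.
Lemma away_eq_sym : symmetric away_eq.
Proof. by move=> u v; apply: eq_sym. Qed.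
Lemma away_eq_trans : transitive away_eq.
Proof.
move=> [g n] [f m] [h p]; rewrite /away_eq /= => /eqP fg /eqP gh.
apply/eqP/(@powa_reg n) => /=.
transitivity (f * a ^+ n * a ^+ p); first by ring.
by rewrite fg mulrAC gh; ring.
Qed.

Canonical away_equiv := EquivRel away_eq away_eq_refl away_eq_sym away_eq_trans.

Definition away := {eq_quot away_eq}.
HB.instance Definition _ : EqQuotient _ away_eq away := EqQuotient.on away.
HB.instance Definition _ := Choice.on away.

Definition away_frac (f : R) (m : nat) : away := \pi_away (f, m).

Lemma away_fracP f m g n :
  reflect (f * a ^+ n = g * a ^+ m) (away_frac f m == away_frac g n).
Proof. by rewrite /away_frac eqmodE; apply: eqP. Qed.

Lemma away_fracE u : exists f m, u = away_frac f m.
Proof. by elim/quotW: u => -[f m]; exists f, m. Qed.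

Definition away_add (u v : away) : away :=
  let: (f, m) := repr u in let: (g, n) := repr v in
  away_frac (f * a ^+ n + g * a ^+ m) (m + n).
Definition away_mul (u v : away) : away :=
  let: (f, m) := repr u in let: (g, n) := repr v in
  away_frac (f * g) (m + n).
Definition away_opp (u : away) : away :=
  let: (f, m) := repr u in away_frac (- f) m.

Let repr_frac f m :
  (repr (away_frac f m)).1 * a ^+ m = f * a ^+ (repr (away_frac f m)).2.
Proof.
by apply/away_fracP; rewrite /away_frac -surjective_pairing reprK.
Qed.

Lemma away_addE f m g n : away_add (away_frac f m) (away_frac g n)
  = away_frac (f * a ^+ n + g * a ^+ m) (m + n).
Proof.
rewrite /away_add; have := repr_frac f m; have := repr_frac g n.
case: (repr _) => g' n'; case: (repr _) => f' m' /= gg' ff'.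
apply/eqP/away_fracP; rewrite !exprD.
transitivity ((f' * a ^+ m) * a ^+ n * a ^+ n' + (g' * a ^+ n) * a ^+ m * a ^+ m').
  by ring.
by rewrite ff' gg'; ring.
Qed.

Lemma away_mulE f m g n :
  away_mul (away_frac f m) (away_frac g n) = away_frac (f * g) (m + n).
Proof.
rewrite /away_mul; have := repr_frac f m; have := repr_frac g n.
case: (repr _) => g' n'; case: (repr _) => f' m' /= gg' ff'.
apply/eqP/away_fracP; rewrite !exprD.
transitivity ((f' * a ^+ m) * (g' * a ^+ n)); first by ring.
by rewrite ff' gg'; ring.
Qed.

Lemma away_oppE f m : away_opp (away_frac f m) = away_frac (- f) m.
Proof.
rewrite /away_opp; have := repr_frac f m; case: (repr _) => f' m' /= ff'.
by apply/eqP/away_fracP; rewrite !mulNr ff'.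
Qed.

Let awayE := (away_addE, away_mulE, away_oppE).

Ltac away_ring :=
  repeat (let u := fresh in move=> u; have [? [? ->]] := away_fracE u; clear u);
  rewrite ?awayE; apply/eqP/away_fracP; rewrite ?exprD ?expr0; ring.

Lemma away_addA : associative away_add. Proof. by away_ring. Qed.
Lemma away_addC : commutative away_add. Proof. by away_ring. Qed.
Lemma away_add0 : left_id (away_frac 0 0) away_add. Proof. by away_ring. Qed.
Lemma away_addN : left_inverse (away_frac 0 0) away_opp away_add.
Proof. by away_ring. Qed.
HB.instance Definition _ :=
  GRing.isZmodule.Build away away_addA away_addC away_add0 away_addN.

Lemma away_mulA : associative away_mul. Proof. by away_ring. Qed.
Lemma away_mulC : commutative away_mul. Proof. by away_ring. Qed.
Lemma away_mul1 : left_id (away_frac 1 0) away_mul. Proof. by away_ring. Qed.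
Lemma away_mulDl : left_distributive away_mul away_add.
Proof. by away_ring. Qed.
Lemma away_one_neq0 : away_frac 1 0 != away_frac 0 0.
Proof. by apply/away_fracP/eqP; rewrite !mulr1 oner_eq0. Qed.
HB.instance Definition _ := GRing.Zmodule_isComNzRing.Build away
  away_mulA away_mulC away_mul1 away_mulDl away_one_neq0.

Definition away_unit : {pred away} := fun u => `[< exists v, v * u = 1 >].
Definition away_inv (u : away) : away :=
  if pselect (exists v, v * u = 1) is left ex then projT1 (cid ex) else u.

Lemma away_mulVr : {in away_unit, left_inverse 1 away_inv *%R}.
Proof.
by move=> u /asboolP; rewrite /away_inv; case: pselect => // ex _; case: cid.
Qed.
Lemma away_unitP u v : v * u = 1 -> away_unit u.
Proof. by move=> vu; apply/asboolP; exists v. Qed.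
Lemma away_inv_out : {in [predC away_unit], away_inv =1 id}.
Proof. by move=> u /asboolP; rewrite /away_inv; case: pselect. Qed.
HB.instance Definition _ := GRing.ComNzRing_hasMulInverse.Build away
  away_mulVr away_unitP away_inv_out.

Definition to_away (f : R) : away := away_frac f 0.

Lemma to_away_is_zmod_morphism : zmod_morphism to_away.
Proof.
move=> f g; transitivity (away_add (to_away f) (away_opp (to_away g))) => //.
rewrite /to_away !awayE.
by apply/eqP/away_fracP; ring.
Qed.
Lemma to_away_is_monoid_morphism : monoid_morphism to_away.
Proof.
split=> // f g; transitivity (away_mul (to_away f) (to_away g)) => //.
rewrite /to_away !awayE.
by apply/eqP/away_fracP; ring.
Qed.
HB.instance Definition _ := GRing.isZmodMorphism.Build R away to_away
  to_away_is_zmod_morphism.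
HB.instance Definition _ := GRing.isMonoidMorphism.Build R away to_away
  to_away_is_monoid_morphism.

Lemma to_away_unit : to_away a \is a GRing.unit.
Proof.
apply/unitrPr; exists (away_frac 1 1).
transitivity (away_mul (away_frac a 0) (away_frac 1 1)) => //.
rewrite awayE.
by apply/eqP/away_fracP; ring.
Qed.

End Localization.

(* k = Z[beta_(k,l)], the polynomial ring on the indices (k, l) <> (0, 0). *)
Definition beta_index := {kl : nat * nat | kl != (0%N, 0%N)}.
Definition kk : comNzRingType := {malg int[{cmonom beta_index}]}.

(* Coefficient of x^k y^l in p(x, y); it is 1 for (k, l) = (0, 0). *)
Definition p_coef (k l : nat) : kk :=
  if insub (k, l) : option beta_index is Some i then mkmalgU (ucm i) 1 else 1.

(* k[[x1, x2]] is built as k[[x1]][[x2]]. *)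
Definition kxx : comNzRingType := fps (fps kk).
Definition bivariate (f : nat -> nat -> kk) : kxx :=
  Fps (fun j => Fps (fun i => f i j)).
Definition kx1 : kxx := fps_const (fps_var kk).
Definition kx2 : kxx := fps_var (fps kk).

Definition kx12_reg : GRing.lreg (kx1 - kx2) :=
  fps_const_subvar_reg (@fps_var_reg kk).

(* k[[x1, x2]][1 / (x1 - x2)] *)
Definition eval_ring : comUnitRingType := away kx12_reg.

Definition x1 : eval_ring := to_away kx12_reg kx1.
Definition x2 : eval_ring := to_away kx12_reg kx2.

Lemma x12_unit : x1 - x2 \is a GRing.unit.
Proof. by rewrite -rmorphB; apply: to_away_unit. Qed.

Definition p12 : eval_ring := to_away kx12_reg (bivariate p_coef).
Definition p21 : eval_ring :=
  to_away kx12_reg (bivariate (fun i j => p_coef j i)).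

Section Complexes.
Variable V : finType.
Implicit Types (T : {set {set V}}) (s t e : {set V}).

(* A pure two-dimensional complex is given by its set of triangles. *)
Definition faces T := [set s : {set V} | [exists t in T, s \subset t]].
Definition edges T := [set e in faces T | #|e| == 2].
Definition euler T : int := #|finset.cover T|%:Z - #|edges T|%:Z + #|T|%:Z.

(* Adjacency of triangles of T across an edge in E. *)
Definition adjacent T (E : {set {set V}}) : rel {set V} := fun t t' =>
  [&& t \in T, t' \in T & [exists e in E, (e \subset t) && (e \subset t')]].

End Complexes.

Section Geometry.
Variables (R : realType) (V : finType) (pos : V -> 'rV[R]_3).
Implicit Types (T : {set {set V}}) (s t : {set V}).

Definition hull s : set 'rV[R]_3 :=
  [set x | exists w : V -> R, [/\ forall v, 0 <= w v,
    \sum_(v in s) w v = 1 & x = \sum_(v in s) w v *: pos v]]%classic.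

Definition affinely_independent s := forall w : V -> R,
  \sum_(v in s) w v = 0 -> \sum_(v in s) w v *: pos v = 0 ->
  {in s, forall v, w v = 0}.

Definition polyhedron T : set 'rV[R]_3 :=
  [set x | exists2 t, t \in T & hull t x]%classic.

Definition geometric_complex T :=
  {in T, forall t, #|t| = 3 /\ affinely_independent t} /\
  {in T &, forall t t', hull t `&` hull t' = hull (t :&: t')}%classic.

Definition enclosed (S : set 'rV[R]_3) (x : 'rV[R]_3) :=
  ~ S x /\ bounded_set (connected_component (~` S)%classic x).

Definition det3 (a b c : 'rV[R]_3) : R :=
  \det (\matrix_(i < 3) [:: a; b; c]`_i).

(* Looking from p to q, the half-plane through x is turned counterclockwise
   about the line pq onto the one through y by an angle in ]0, pi[: this is a
   left-handed rotation about q - p, whence the sign. *)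
Definition ccw (p q x y : 'rV[R]_3) := det3 (q - p) (x - p) (y - p) < 0.

(* Looking from p to q and turning counterclockwise about pq from the
   half-plane through d, one meets a before b. The three angles from d to a,
   from a to b and from b to d then add up to a full turn, so that at least two
   of them are smaller than pi; in the other cyclic order at most one is. *)
Definition met_first (p q d a b : 'rV[R]_3) :=
  [|| ccw p q d a && ccw p q a b, ccw p q a b && ccw p q b d
    | ccw p q b d && ccw p q d a].

End Geometry.

(* Piecewise linear foams with a triangulation: the vertices are points of R^3
   (see is_foam) and the triangles are straight. The orientation of a triangle t is given by its directed
   boundary edges: orient t u v says that the boundary runs from u to v. *)
Record foam (V : finType) := Foam {
  thin : {set {set V}};
  double : {set {set V}};
  orient : {set V} -> rel V;
  dots : {set V} -> nat }.

(* true is the color 1, false is the color 2. *)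
Definition color := bool.

Section Foams.
Variables (V : finType) (F : foam V).

Definition triangles := thin F :|: double F.
Definition singular_edges := edges (thin F) :&: edges (double F).
Definition regular_edges := edges triangles :\: singular_edges.

(* A facet, as the set of its triangles. *)
Definition facet (t : {set V}) : {set {set V}} :=
  [set t' | connect (adjacent triangles regular_edges) t t'].
Definition thin_facets := [set facet t | t in thin F].
Definition thin_facet := {f : {set {set V}} | f \in thin_facets}.

(* A singular circle, as the set of its edges. *)
Definition singular_circle (e : {set V}) : {set {set V}} :=
  [set e' | connect (fun e1 e2 => [&& e1 \in singular_edges,
     e2 \in singular_edges & e1 :&: e2 != finset.set0]) e e'].
Definition singular_circles := [set singular_circle e | e in singular_edges].

(* Same sheet of the foam near v. *)
Definition same_sheet (v : V) : rel {set V} :=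
  connect (adjacent triangles [set e in regular_edges | v \in e]).

Definition oriented_triangle (t : {set V}) := exists a b c,
  t = [set a; b; c] /\
  forall u v, orient F t u v = ((u, v) \in [:: (a, b); (b, c); (c, a)]).

(* The local models of a closed foam: near an edge, and near a vertex v, where
   the foam is either a disk or three half-disks glued along their diameter,
   formed by the two singular edges at v. *)
Definition edge_condition := forall e, e \in edges triangles ->
  (#|[set t in thin F | e \subset t]|, #|[set t in double F | e \subset t]|)
    \in [:: (2, 0); (0, 2); (2, 1)]%N.

Definition vertex_condition := forall v, v \in finset.cover triangles ->
  ([set e in singular_edges | v \in e] = finset.set0 /\
   {in triangles &, forall t t' : {set V}, v \in t -> v \in t' -> same_sheet v t t'})
  \/ (exists a b : {set V}, [/\ a != b, [set e in singular_edges | v \in e] = [set a; b] &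
   {in triangles, forall t : {set V}, v \in t ->
     (exists2 t' : {set V}, a \subset t' & same_sheet v t t') /\
     (exists2 t' : {set V}, b \subset t' & same_sheet v t t')}]).

(* Orientations match across edges, except between the two thin facets at a
   singular circle. *)
Definition coherent := {in triangles &, forall (t t' : {set V}), forall u v, t != t' -> u != v ->
  [set u; v] \subset t -> [set u; v] \subset t' ->
  ([set u; v] \in singular_edges -> (t \in thin F) != (t' \in thin F)) ->
  orient F t u v -> orient F t' v u}.

Record is_foam (R : realType) (pos : V -> 'rV[R]_3) : Prop := {
  foam_embedded : geometric_complex pos triangles;
  foam_types : [disjoint thin F & double F];
  foam_edges : edge_condition;
  foam_vertices : vertex_condition;
  foam_oriented : {in triangles, forall t, oriented_triangle t};
  foam_coherent : coherent;
  foam_dots : {in double F, forall t, dots F t = 0%N} }.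

Definition is_coloring (c : {ffun thin_facet -> color}) :=
  [forall e in singular_edges, forall f : thin_facet, forall g : thin_facet,
   forall t in val f, forall t' in val g,
   [&& e \subset t, e \subset t' & t != t'] ==> (c f != c g)].

Section Evaluation.
Variables (R : realType) (pos : V -> 'rV[R]_3) (c : {ffun thin_facet -> color}).

Definition surface (i : color) : {set {set V}} :=
  double F :|: \bigcup_(f | c f == i) val f.

Definition dots_of_color (i : color) : nat :=
  (\sum_(f | c f == i) \sum_(t in val f) dots F t)%N.

(* The edge runs from u to v along the boundary of the thin triangles, with
   third vertices a and b; d is the third vertex of the double triangle. With
   the outward normal first, the boundary orientation of a thin facet is the
   orientation of the singular circle. *)
Definition edge_positive (e : {set V}) :=
  [exists u, exists v, exists a, exists b, exists d, exists f : thin_facet,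
   [&& e == [set u; v], a |: e \in val f, b |: e \in thin F,
       d |: e \in double F, orient F (a |: e) u v,
       met_first (pos u) (pos v) (pos d) (pos a) (pos b) & c f == true]].

(* In a foam the edges of a circle are all positive or all negative. *)
Definition circle_positive (C : {set {set V}}) :=
  [forall e in C, edge_positive e].

Definition theta_plus := #|[set C in singular_circles | circle_positive C]|.

(* The halved Euler characteristics are even: those of closed orientable
   surfaces. *)
Definition color_evaluation : eval_ring :=
  let half z := (z %/ 2)%Z in
  (-1) ^ (theta_plus%:Z + half (euler (surface false)))
  * (x1 ^+ dots_of_color true * x2 ^+ dots_of_color false
     * p12 ^ half (euler (surface true)) * p21 ^ half (euler (surface false))
     / (x1 - x2) ^ half (euler (thin F))).

End Evaluation.

Definition evaluation (R : realType) (pos : V -> 'rV[R]_3) : eval_ring :=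
  \sum_(c | is_coloring c) color_evaluation pos c.

End Foams.

Definition add_dot (V : finType) (F : foam V) (t : {set V}) : foam V :=
  Foam (thin F) (double F) (orient F) (fun t' => (dots F t' + (t' == t))%N).

(* Two-dimensional complexes whose triangles carry labels, up to relabelling of
   the vertices and stellar subdivision: by the theorem of Alexander and Newman,
   up to piecewise linear homeomorphisms respecting the labels. *)
Record labelled_complex (L : Type) := LabelledComplex {
  lvertex : finType;
  cells : L -> {set {set lvertex}} }.

(* Starring at the simplex s, with None as new vertex. *)
Definition stellar_subdivision (L : Type) (K : labelled_complex L)
    (s : {set lvertex K}) : labelled_complex L :=
  @LabelledComplex L (option (lvertex K)) (fun l =>
    [set Some @: (t : {set lvertex K})
       | t in [set t in cells K l | ~~ (s \subset t)]] :|: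
    \bigcup_(t in cells K l | s \subset t)
      [set None |: Some @: (t :\ v) | v in s]).

Definition vertex_used (L : Type) (K : labelled_complex L) (v : lvertex K) :=
  exists l, v \in finset.cover (cells K l).

Inductive comb_equivalent (L : Type) :
    labelled_complex L -> labelled_complex L -> Prop :=
| CombIso K K' (f : lvertex K -> lvertex K') of
    (forall u v, vertex_used u -> vertex_used v -> f u = f v -> u = v) &
    (forall l, cells K' l = [set f @: (t : {set lvertex K}) | t in cells K l]) :
    comb_equivalent K K'
| CombStar K (s : {set lvertex K}) of (1 < #|s|)%N :
    comb_equivalent K (stellar_subdivision s)
| CombSym K K' of comb_equivalent K K' : comb_equivalent K' K
| CombTrans K K' K'' of comb_equivalent K K' & comb_equivalent K' K'' :
    comb_equivalent K K''.

(* The neck, a solid cylinder: its side is the tube, cut by a horizontal disk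
   into an upper and a lower half; the caps are its top and its bottom. *)
Inductive neck_part := TopCap | TopTube | MiddleDisk | BottomTube | BottomCap.

(* Triangular prism model; (h, j) is the j-th vertex of the triangle at height
   h, where h = 0, 1, 2 from bottom to top. *)
Definition level (h : 'I_3) : {set 'I_3 * 'I_3} := [set (h, j) | j : 'I_3].
Definition band (h k : 'I_3) : {set {set 'I_3 * 'I_3}} :=
  [set [set (h, j); (h, j + 1); (k, j)] | j : 'I_3] :|:
  [set [set (h, j + 1); (k, j); (k, j + 1)] | j : 'I_3].

Definition standard_neck : labelled_complex neck_part :=
  @LabelledComplex neck_part ('I_3 * 'I_3)%type (fun r => match r with
    | TopCap => [set level (inord 2)]
    | TopTube => band (inord 1) (inord 2)
    | MiddleDisk => [set level (inord 1)]
    | BottomTube => band (inord 0) (inord 1)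
    | BottomCap => [set level (inord 0)]
    end).

Section NeckCutting.
Variables (R : realType) (V : finType) (pos : V -> 'rV[R]_3).
Variables (F F' : foam V) (N : neck_part -> {set {set V}}).

Let tube := N TopTube :|: N BottomTube.
Let caps := N TopCap :|: N BottomCap.
Let rest := triangles F :\: (tube :|: N MiddleDisk).

Definition middle_circle := edges (N TopTube) :&: edges (N MiddleDisk).

(* F' is obtained from F by removing the double disk and the open tube and
   gluing in the two caps, without dots. *)
Record neck_cut : Prop := {
  cut_embedded : geometric_complex pos (triangles F :|: triangles F');
  cut_neck : comb_equivalent (LabelledComplex N) standard_neck;
  cut_tube_thin : tube \subset thin F;
  cut_disk_double : N MiddleDisk \subset double F;
  cut_disk_inside : forall x, polyhedron pos (N MiddleDisk) x ->
    ~ polyhedron pos tube x -> enclosed (polyhedron pos (tube :|: caps)) x;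
  cut_one_circle : forall e, e \in singular_edges F ->
    ~~ [disjoint e & finset.cover tube] -> e \in middle_circle;
  (* the rest of the foam meets the neck along the two end circles only *)
  cut_rest : faces rest :&: faces (tube :|: N MiddleDisk :|: caps) \subset
    (faces (N TopTube) :&: faces (N TopCap)) :|:
    (faces (N BottomTube) :&: faces (N BottomCap));
  cut_thin : thin F' = (thin F :\: tube) :|: caps;
  cut_double : double F' = double F :\: N MiddleDisk;
  cut_orient : {in rest, forall t, orient F' t =2 orient F t};
  cut_dots : {in rest, forall t, dots F' t = dots F t};
  cut_tube_dots : {in tube, forall t, dots F t = 0%N};
  cut_cap_dots : {in caps, forall t, dots F' t = 0%N} }.

Definition positive_when_top_is_1 :=
  forall c : {ffun thin_facet F -> color}, is_coloring c ->
  (forall f, val f :&: N TopTube != finset.set0 -> c f = true) ->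
  circle_positive pos c middle_circle.

End NeckCutting.

(* Main.v *)
Require Import Defs.
From mathcomp Require Import all_boot all_order all_algebra perm reals ring.
Import Order.TTheory GRing.Theory Num.Theory.

(* Colorings of F correspond to the colorings of F' in which the two caps have
   different colors; the other colorings of F' contribute equally to F1 and F2.
   For corresponding colorings the one-colored surfaces have the same Euler
   characteristic, that of the thin surface grows by 2 as a tube is replaced by
   two disks, and the middle circle is positive exactly when the top facet is
   colored 1. So cutting divides the evaluation by x1 - x2, up to the sign
   of the middle circle, and the difference of the two dots multiplies it by
   x1 - x2, up to the same sign.
   The neck is only known up to stellar moves and relabellings. These preserve
   the alternating face count, the dimension, the inclusions and the strong
   connectivity of the intersections of its parts, all of which are therefore
   computed on the standard prism. *)

Set Implicit Arguments.
Unset Strict Implicit.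
Unset Printing Implicit Defensive.
Local Open Scope ring_scope.

(** * Face families and stellar subdivision *)

(** No triangle of the neck [N] is known explicitly, so even the existence of an edge on the middle
    circle must come from properties that survive starring in both directions. [alt_sum] counts the
    empty face and accepts arbitrary families of sets, which makes it exactly invariant; [linked]
    speaks of two-valued functions because colorings and connectivity predicates are both of this
    kind. Facets of the two foams are different sets of triangles, so colorings are handled as
    functions on triangles with a condition at each edge, and compared by the relation [matching].
    The orientation hypothesis yields only that the middle circle is positive when the top facet has
    color 1. The converse comes from exchanging the two colors everywhere: this is again a coloring,
    and it exchanges the two thin triangles in the cyclic order at a singular edge. *)

Section Families.
Variable V : finType.
Implicit Types (C D T : {set {set V}}) (r t : {set V}).

(** On the faces of a nonempty complex this is one minus the Euler characteristic, since the empty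
    face counts; it vanishes on every nonempty simplex. *)
Definition alt_sum C : int := \sum_(r in C) (-1) ^+ #|r|.

Definition dim_le n C := {in C, forall r, (#|r| <= n)%N}.

(* Strong connectivity: the faces with n.+1 vertices are not separated by a
   function that is constant across their common faces with n vertices. *)
Definition linked n C := forall k : {set V} -> bool,
  {in C &, forall t t', #|t| = n.+1 -> #|t'| = n.+1 -> (n <= #|t :&: t'|)%N ->
    k t = k t'} ->
  {in C &, forall t t', #|t| = n.+1 -> #|t'| = n.+1 -> k t = k t'}.

(** Adding or removing [v] is an involution on the sets satisfying [P], and it reverses the sign. *)
Lemma alt_sum_toggle (P : pred {set V}) v :
  (forall r, P (v |: r) = P r) -> \sum_(r | P r) (-1) ^+ #|r| = 0 :> int.
Proof.
move=> Pv; rewrite (bigID (fun r : {set V} => v \in r)) /=.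
rewrite (reindex_onto (fun r => v |: r) (fun r => r :\ v)) /=; last first.
  by move=> r /andP[_ vr]; rewrite setD1K.
rewrite -[X in X + _]opprK -sumrN addrC; apply/eqP; rewrite subr_eq0; apply/eqP.
apply: eq_big => [r|r /andP[_ vr]];
  last by rewrite cardsU1 vr exprS mulN1r opprK.
rewrite Pv setU11 andbT; congr (_ && _).
by apply/idP/eqP=> [vr|<-]; [rewrite setU1K | rewrite setD11].
Qed.

Lemma alt_sumU C D :
  alt_sum (C :|: D) = alt_sum C + alt_sum D - alt_sum (C :&: D).
Proof.
rewrite /alt_sum ![\sum_(r in _) _]big_mkcond -big_split -sumrB /=.
apply: eq_bigr => r _; rewrite !inE.
by case: (r \in C); case: (r \in D); rewrite /= ?subr0 ?addr0 ?add0r ?addrK.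
Qed.

Lemma facesP T r : reflect (exists2 t, t \in T & r \subset t) (r \in faces T).
Proof.
by rewrite inE; apply: (iffP exists_inP) => -[t]; exists t.
Qed.

Lemma mem_faces T t : t \in T -> t \in faces T.
Proof. by move=> tT; apply/facesP; exists t. Qed.

Lemma facesU S T : faces (S :|: T) = faces S :|: faces T.
Proof.
apply/setP=> r; rewrite in_setU; apply/facesP/orP => [[t]|].
  by rewrite inE => /orP[] tST rt; [left|right]; apply/facesP; exists t.
by case=> /facesP[t tST rt]; exists t => //; rewrite inE tST ?orbT.
Qed.

End Families.

(** * Sets of vertices after adjoining one new vertex *)

Section Lift.
Variable V : finType.
Implicit Types (w : {set V}) (b : bool) (r : {set option V}).

(** The bit [b] records whether the new vertex [None] belongs, so that a set of vertices after
    starring amounts to a bit and an old set. *)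
Definition lift_set b w : {set option V} :=
  if b then None |: Some @: w else Some @: w.

Arguments lift_set : simpl never.

Lemma lift_setE b w (x : option V) :
  (x \in lift_set b w) = if x is Some v then v \in w else b.
Proof.
have SomeE v : (Some v \in Some @: w) = (v \in w).
  by rewrite mem_imset // => ? ? [].
have NoneF : (None \in Some @: w) = false by apply/imsetP=> -[].
by case: b; case: x => [v|]; rewrite /lift_set ?in_setU1 ?SomeE ?NoneF.
Qed.

Lemma lift_setP r : exists b w, r = lift_set b w.
Proof.
exists (None \in r), (Some @^-1: r); apply/setP=> x.
by rewrite lift_setE; case: x => [v|//]; rewrite inE.
Qed.

Lemma lift_setK b w :
  (None \in lift_set b w = b) * (Some @^-1: lift_set b w = w).
Proof.
by split; [rewrite lift_setE | apply/setP=> v; rewrite inE lift_setE].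
Qed.

Lemma lift_set_bij : bijective (fun bw : bool * {set V} => lift_set bw.1 bw.2).
Proof.
exists (fun r : {set option V} => (None \in r, Some @^-1: r)) => [[b w]|r] /=.
  by rewrite !lift_setK.
by have [b [w ->]] := lift_setP r; rewrite !lift_setK.
Qed.

Lemma card_lift b w : #|lift_set b w| = (b + #|w|)%N.
Proof.
have cardS : #|Some @: w| = #|w| by rewrite card_imset // => ? ? [].
case: b => //=; rewrite cardsU1 cardS; case: imsetP => // -[] //.
Qed.

Lemma lift_setI b w b' w' :
  lift_set b w :&: lift_set b' w' = lift_set (b && b') (w :&: w').
Proof. by apply/setP=> -[v|]; rewrite !inE !lift_setE ?inE. Qed.

Lemma lift_subset b w b' w' :
  (lift_set b w \subset lift_set b' w') = (b ==> b') && (w \subset w').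
Proof.
apply/subsetP/andP=> [sub|[bb' /subsetP ww'] [v|]]; last 2 first.
- by rewrite !lift_setE; apply: ww'.
- by rewrite !lift_setE => bT; rewrite bT in bb'.
split; first by apply/implyP=> bT; have := sub None; rewrite !lift_setE; apply.
by apply/subsetP=> v vw; have := sub (Some v); rewrite !lift_setE; apply.
Qed.

End Lift.
Arguments lift_set {V} b w : simpl never.

(** * Invariance of face families under starring *)

Section Star.
Variables (V : finType) (s : {set V}).
Hypothesis s_gt1 : (1 < #|s|)%N.
Implicit Types (C D T : {set {set V}}) (r t w : {set V}) (b : bool).

(* See faces_star: starring at s a complex with face family C. *)
Definition star (C : {set {set V}}) : {set {set option V}} :=
  [set r : {set option V} | ~~ (s \subset Some @^-1: r)
         & (if None \in r then Some @^-1: r :|: s else Some @^-1: r) \in C].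

Lemma in_star C b w : (lift_set b w \in star C) =
  ~~ (s \subset w) && ((if b then w :|: s else w) \in C).
Proof. by rewrite inE !lift_setK. Qed.

Lemma starI C D : star (C :&: D) = star C :&: star D.
Proof. by apply/setP=> r; rewrite !inE; case: (~~ _) => //=. Qed.

(** A set [w] lies in [t :\ v] for some [v] in [s] exactly when it lies in [t] and does not contain
    [s]; a face with the new vertex moreover needs a [t] containing both [w] and [s]. *)
Lemma faces_star T : faces ([set Some @: (t :
  {set V}) | t in [set t in T | ~~ (s \subset t)]]
    :|: \bigcup_(t in T | s \subset t) [set None |: Some @: (t :\ v) | v in s])
  = star (faces T).
Proof.
apply/setP=> r; have [b [w ->]] := lift_setP r; rewrite in_star {r}.
apply/facesP/andP => [[r]|[sw]].
  rewrite inE => /orP[/imsetP[t]|/bigcupP[t /andP[tT st] /imsetP[v vs]]] =>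
    [|->].
    rewrite inE => /andP[tT st] ->; rewrite -/(lift_set false t) lift_subset.
    case: b => //= wt; split; last by apply/facesP; exists t.
    by apply: contra st => /subset_trans; apply.
  rewrite -/(lift_set true (t :\ v)) lift_subset => /andP[_].
  rewrite subsetD1 => /andP[wt vw]; split.
    by apply: contra vw => /subsetP/(_ v vs).
  by apply/facesP; exists t => //; case: b => //; rewrite subUset wt.
case/facesP=> t tT; case: (boolP (s \subset t)) => st; last first.
  case: b => [|wt]; first by rewrite subUset (negPf st) andbF.
  exists (lift_set false t); last by rewrite lift_subset.
  by rewrite inE imset_f // inE tT.
move=> wst; have {wst} wt : w \subset t.
  by case: b wst => //; rewrite subUset => /andP[].
have /subsetPn[v vs vw] := sw.
exists (lift_set true (t :\ v)).
  rewrite inE; apply/orP; right; apply/bigcupP; exists t; first by rewrite tT.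
  by apply/imsetP; exists v.
by rewrite lift_subset implybT subsetD1 wt.
Qed.

(** The sets [w] with [w :|: s] in [C] are stable under toggling a vertex of [s], so their signs
    cancel. Those containing [s] are the faces that starring removes; the others, joined with the
    new vertex and so with opposite sign, are the faces that it adds. *)
Lemma alt_sum_star C : alt_sum (star C) = alt_sum C.
Proof.
rewrite /alt_sum (reindex _ (onW_bij _ (@lift_set_bij V))) /=.
rewrite -(pair_big_dep predT (fun b w => lift_set b w \in star C)
  (fun b w => (-1) ^+ #|lift_set b w|)) /=.
rewrite big_bool /= [RHS](bigID (fun r : {set V} => s \subset r)) /=;
  congr (_ + _); last first.
  by apply: eq_big => [w|w _]; [rewrite in_star andbC | rewrite card_lift].
have [v vs] : exists v, v \in s by apply/card_gt0P; apply: ltnW.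
have := @alt_sum_toggle V (fun w => w :|: s \in C) v.
rewrite (bigID (fun r : {set V} => s \subset r)) /= => /(_ _)/eqP.
rewrite addr_eq0 => tog.
transitivity (- \sum_(w | (w :|: s \in C) && ~~ (s \subset w)) (-1) ^+ #|w| :
  int).
  rewrite -sumrN; apply: eq_big => w; first by rewrite in_star andbC.
  by rewrite card_lift exprS mulN1r.
rewrite -(eqP (tog _)); last first.
  move=> r; rewrite setUAC [_ :|: r]setUC.
  by rewrite (setUidPr (_ : [set v] \subset s)) // sub1set.
apply: eq_bigl => w; case: (boolP (s \subset w)) => sw;
  rewrite ?andbF // !andbT.
by rewrite (setUidPl sw).
Qed.

Lemma setD1_setU v r : v \in s -> s \subset r -> r :\ v :|: s = r.
Proof.
move=> vs /subsetP sr; apply/setP=> x; rewrite !inE.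
case: eqP => [->|_] /=; first by rewrite vs sr.
by case: (boolP (x \in s)) => [/sr ->|_]; rewrite ?orbF.
Qed.

Lemma not_subset_setD1 v r : v \in s -> ~~ (s \subset r :\ v).
Proof. by move=> vs; rewrite subsetD1 vs andbF. Qed.

Lemma starred_vertex : exists v, v \in s.
Proof. by apply/card_gt0P; apply: ltnW. Qed.

Lemma star_same C r : ~~ (s \subset r) ->
  (lift_set false r \in star C) = (r \in C).
Proof. by rewrite in_star => ->. Qed.

(** With [star_same] this recovers [C] from [star C]: every [r] is detected by a face of the same
    cardinality. *)
Lemma star_new C v r : v \in s -> s \subset r ->
  (lift_set true (r :\ v) \in star C) = (r \in C).
Proof. by move=> vs sr; rewrite in_star not_subset_setD1 ?setD1_setU. Qed.

Lemma dim_le_star n C : dim_le n (star C) <-> dim_le n C.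
Proof.
have [v vs] := starred_vertex; split=> dimC r.
  have [sr|sr] := boolP (s \subset r); last first.
    by rewrite -star_same // => /dimC; rewrite card_lift.
  by rewrite -(star_new C vs sr) => /dimC;
    rewrite card_lift (cardsD1 v r) (subsetP sr).
have [b [w ->]] := lift_setP r; rewrite in_star card_lift {r} => /andP[sw].
case: b => [|/dimC//] /dimC; apply: leq_trans.
apply: proper_card; rewrite properEneq subsetUl andbT.
by apply: contraNneq sw => ->; apply: subsetUr.
Qed.

Lemma star_subset C D : (star C \subset star D) = (C \subset D).
Proof.
have [v vs] := starred_vertex.
apply/subsetP/subsetP=> CD r; last first.
  have [b [w ->]] := lift_setP r; rewrite !in_star => /andP[-> /=]; exact: CD.
have [sr|sr] := boolP (s \subset r); last by rewrite -!star_same //; apply: CD.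
by rewrite -!(star_new _ vs sr); apply: CD.
Qed.

(** The carrier of [r]: the smallest simplex of the original complex whose subdivision contains
    [r]. *)
Definition star_parent (r : {set option V}) : {set V} :=
  if None \in r then Some @^-1: r :|: s else Some @^-1: r.

Lemma star_parentE b w :
  star_parent (lift_set b w) = if b then w :|: s else w.
Proof. by rewrite /star_parent !lift_setK. Qed.

(** One of the simplices of full dimension into which [t] is divided; [v] selects which. *)
Definition star_child (t : {set V}) v : {set option V} :=
  if s \subset t then lift_set true (t :\ v) else lift_set false t.

Lemma ltn_cardU w : ~~ (s \subset w) -> (#|w| < #|w :|: s|)%N.
Proof.
move=> sw; apply: proper_card; rewrite properEneq subsetUl andbT.
by apply: contraNneq sw => ->; apply: subsetUr.
Qed.

Lemma star_child_top C t v : v \in s -> t \in C ->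
  [/\ star_child t v \in star C, #|star_child t v| = #|t|
    & star_parent (star_child t v) = t].
Proof.
move=> vs tC; rewrite /star_child; case: ifP => [st|/negbT st].
  rewrite star_new // star_parentE setD1_setU // card_lift.
  by rewrite (cardsD1 v t) (subsetP st).
by rewrite star_same // star_parentE card_lift.
Qed.

(** A new face with base [w] has one vertex more than [w], and so has at most as many vertices as
    its carrier [w :|: s]; the dimension bound gives equality. *)
Lemma star_parent_top n C (r : {set option V}) : dim_le n C ->
  r \in star C -> #|r| = n -> star_parent r \in C /\ #|star_parent r| = n.
Proof.
move=> dimC; have [b [w ->]] := lift_setP r.
rewrite in_star card_lift star_parentE.
case: b => /= /andP[sw wC] cw; split => //.
by apply/eqP; rewrite eqn_leq dimC //= -cw ltn_cardU.
Qed.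

(** Adjacent top faces have equal or adjacent carriers, so a function on [C] pulls back along
    [star_parent]. Conversely a locally constant function on the star takes one value on all the top
    faces in a given carrier, and adjacent carriers contain adjacent top faces. *)
Lemma linked_star n C : dim_le n.+1 C -> linked n (star C) <-> linked n C.
Proof.
move=> dimC; have [v vs] := starred_vertex.
split=> linkC k k_loc.
  move=> t t' tC t'C ct ct'.
  have [cC cc <-] := star_child_top vs tC.
  have [cC' cc' <-] := star_child_top vs t'C.
  apply: (linkC (k \o star_parent));
    rewrite ?cc ?cc' //= {t t' tC t'C ct ct' cC cC' cc cc'}.
  move=> r r' rC r'C cr cr' rr'.
  have [pC cp] := star_parent_top dimC rC cr.
  have [p'C cp'] := star_parent_top dimC r'C cr'.
  apply: k_loc => //; apply: leq_trans rr' _ => {pC cp p'C cp' cr cr'}.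
  move: rC r'C; have [b [w ->]] := lift_setP r; have [b' [w' ->]] :=
    lift_setP r'.
  rewrite !in_star !star_parentE lift_setI card_lift =>
    /andP[sw _] /andP[sw' _].
  case: b; case: b'; rewrite /= ?add0n.
  (* The shared new vertex is made up for by a vertex of [s] outside [w :&: w']. *)
  - rewrite add1n -setUIl; apply: ltn_cardU.
    by apply: contra sw => /subset_trans; apply; apply: subsetIl.
  - by apply: subset_leq_card; apply: setSI; apply: subsetUl.
  - by apply: subset_leq_card; apply: setIS; apply: subsetUl.
  - by [].
(* The pieces of one top simplex are pairwise adjacent: those omitting [u] and [v] share the new
   vertex and everything else. *)
have k_child t u : t \in C -> #|t| = n.+1 -> s \subset t -> u \in s ->
    k (lift_set true (t :\ u)) = k (lift_set true (t :\ v)).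
  move=> tC ct st us; apply: k_loc; rewrite ?star_new // ?card_lift.
  - by rewrite -ct (cardsD1 u t) (subsetP st).
  - by rewrite -ct (cardsD1 v t) (subsetP st).
  rewrite lift_setI card_lift /=.
  have -> : (t :\ u) :&: (t :\ v) = (t :\ u) :\ v.
    by apply/setP=> x; rewrite !inE; case: (x \in t);
      rewrite ?andbF ?andbT // andbC.
  have [ctu] : (#|t :\ u|.+1 = n.+1)%N by rewrite -ct (cardsD1 u t) (subsetP
    st).
  by rewrite -[leqLHS]ctu (cardsD1 v (t :\ u)) leq_add2r; case: (v \in _).
(* The piece of [t] omitting a vertex [u] of [s] that [t'] lacks still contains all of
   [t :&: t']. *)
have k_mixed t t' : t \in C -> t' \in C -> #|t| = n.+1 -> #|t'| = n.+1 ->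
    s \subset t -> ~~ (s \subset t') -> (n <= #|t :&: t'|)%N ->
    k (lift_set true (t :\ v)) = k (lift_set false t').
  move=> tC t'C ct ct' st st' tt'; have /subsetPn[u us ut'] := st'.
  rewrite -(k_child _ u) //; apply: k_loc;
    rewrite ?star_new ?star_same ?card_lift //.
    by rewrite -ct (cardsD1 u t) (subsetP st).
  rewrite lift_setI card_lift /= add0n; apply: leq_trans tt' _.
  apply/subset_leq_card/subsetP=> x; rewrite !inE => /andP[-> xt'].
  by rewrite xt' !andbT; apply: contraNneq ut' => <-.
(* A new top face with base [w] is the piece of its carrier omitting a vertex [u] of [s] outside
   [w]; comparing cardinalities shows that only [u] is missing. *)
have k_parent (r : {set option V}) : r \in star C -> #|r| = n.+1 ->
  k r = k (star_child (star_parent r) v).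
  move=> rC cr; have [] := star_parent_top dimC rC cr.
  move: rC cr; have [b [w ->]] := lift_setP r.
  rewrite in_star star_parentE card_lift /star_child.
  case: b => /= /andP[sw wC] cw tC ct; last by rewrite (negPf sw).
  rewrite subsetUr; have /subsetPn[u us uw] := sw.
  rewrite -(k_child _ u) ?subsetUr //; congr (k (lift_set _ _)).
  apply/eqP; rewrite eqEcard subsetD1 subsetUl uw /= -ltnS -add1n.
  by move: ct; rewrite (cardsD1 u) inE us orbT -cw => ->.
move=> r r' rC r'C cr cr'; rewrite (k_parent r) // (k_parent r') //.
have [pC cp] := star_parent_top dimC rC cr.
have [p'C cp'] := star_parent_top dimC r'C cr'.
apply: (linkC (fun t => k (star_child t v))) =>
  // {r r' rC r'C cr cr' pC cp p'C cp'}.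
move=> t t' tC t'C ct ct' tt'; rewrite /star_child.
case: ifPn => st; case: ifPn => st'.
- apply: k_loc; rewrite ?star_new ?card_lift //=.
  + by rewrite -ct (cardsD1 v t) (subsetP st).
  + by rewrite -ct' (cardsD1 v t') (subsetP st').
  + by rewrite lift_setI card_lift -setDIl; move: tt';
    rewrite (cardsD1 v) inE !(subsetP _ v vs).
- exact: k_mixed.
- by apply/esym/k_mixed; rewrite // setIC.
- by apply: k_loc; rewrite ?star_same ?lift_setI ?card_lift.
Qed.

End Star.

(** * Invariance under combinatorial equivalence *)

Section Relabel.
Variables (V W : finType) (f : V -> W) (used : V -> Prop).
Hypothesis f_inj : forall u v, used u -> used v -> f u = f v -> u = v.
Implicit Types (C D T : {set {set V}}) (r t : {set V}).

Definition relabel C : {set {set W}} := [set f @: r | r : {set V} in C].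
(** [CombIso] asks for injectivity on the used vertices only, so images can be compared only for
    sets of such vertices. *)
Definition set_used r := forall v, v \in r -> used v.
Definition family_used C := forall r, r \in C -> set_used r.

Lemma imset_used_subset r r' : set_used r -> set_used r' ->
  (f @: r \subset f @: r') = (r \subset r').
Proof.
move=> ur ur'; apply/idP/idP=> [/subsetP rr'|]; last exact: imsetS.
apply/subsetP=> v vr; have /imsetP[u ur'u /f_inj -> //] := rr' _ (imset_f f vr).
  exact: ur.
exact: ur'.
Qed.

Lemma imset_used_inj r r' : set_used r -> set_used r' -> f @: r = f @: r' ->
  r = r'.
Proof.
by move=> ur ur' /eqP; rewrite !eqEsubset !imset_used_subset // -eqEsubset =>
  /eqP.
Qed.

Lemma card_imset_used r : set_used r -> #|f @: r| = #|r|.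
Proof. by move=> ur; apply: card_in_imset => u v ? ? /f_inj; apply; apply: ur.
Qed.

Lemma imset_usedI r r' : set_used r -> set_used r' ->
  f @: (r :&: r') = f @: r :&: f @: r'.
Proof.
move=> ur ur'; apply: imsetI => u v /ur uu /ur' uv; exact: f_inj.
Qed.

Lemma faces_relabel T : faces (relabel T) = relabel (faces T).
Proof.
apply/setP=> r; apply/facesP/imsetP => [[_ /imsetP[t tT ->] rt]|].
  exists (t :&: f @^-1: r); first by apply/facesP; exists t => //;
    apply: subsetIl.
  apply/setP=> y; apply/idP/imsetP=> [yr|[x]];
    last by rewrite !inE => /andP[_ ?] ->.
  by have /imsetP[x xt yx] := subsetP rt y yr; exists x; rewrite // !inE xt -yx.
by case=> r' /facesP[t tT r't] ->; exists (f @: t); rewrite ?imset_f ?imsetS.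
Qed.

Lemma relabelI C D : family_used C -> family_used D ->
  relabel (C :&: D) = relabel C :&: relabel D.
Proof.
by move=> uC uD; apply: imsetI => r r' rC r'D; apply: imset_used_inj;
  [apply: uC | apply: uD].
Qed.

Lemma alt_sum_relabel C : family_used C -> alt_sum (relabel C) = alt_sum C.
Proof.
move=> uC; rewrite /alt_sum /relabel big_imset /=; last first.
  by move=> r r' /uC ? /uC ?; apply: imset_used_inj.
by apply: eq_bigr => r /uC /card_imset_used ->.
Qed.

Lemma dim_le_relabel n C : family_used C -> dim_le n (relabel C) <-> dim_le n C.
Proof.
move=> uC; split=> dimC r => [rC|/imsetP[r' r'C ->]].
  by rewrite -card_imset_used; [apply/dimC/imset_f | apply: uC].
by rewrite card_imset_used; [apply: dimC | apply: uC].
Qed.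

Lemma relabel_subset C D : family_used C -> family_used D ->
  (relabel C \subset relabel D) = (C \subset D).
Proof.
move=> uC uD; apply/idP/idP=> [/subsetP CD|]; last exact: imsetS.
apply/subsetP=> r rC; have /imsetP[r' r'D] := CD _ (imset_f _ rC).
by move/imset_used_inj => ->; [| apply: uC | apply: uD].
Qed.

Lemma linked_relabel n C : family_used C -> linked n (relabel C) <-> linked n C.
Proof.
move=> uC; split=> linkC k k_loc.
  move=> t t' tC t'C ct ct'; have ut := uC _ tC; have ut' := uC _ t'C.
  pose kf (q : {set W}) := [exists r in C, (f @: r == q) && k r].
  have kfE r : r \in C -> kf (f @: r) = k r.
    move=> rC; apply/exists_inP/idP => [[r' r'C /andP[/eqP]]|kr];
      last by exists r; rewrite ?eqxx.
    by move/imset_used_inj => -> //; apply: uC.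
  rewrite -!kfE //; apply: linkC; rewrite ?imset_f ?card_imset_used //.
  move=> _ _ /imsetP[r rC ->] /imsetP[r' r'C ->].
  have ur := uC _ rC; have ur' := uC _ r'C;
    rewrite !card_imset_used // -imset_usedI //.
  rewrite card_imset_used => [cr cr' rr'|v /setIP[/ur]//].
  by rewrite !kfE //; apply: k_loc.
move=> _ _ /imsetP[t tC ->] /imsetP[t' t'C ->].
have ut := uC _ tC; have ut' := uC _ t'C; rewrite !card_imset_used // => ct ct'.
apply: (linkC (fun r => k (f @: r))) => // r r' rC r'C cr cr' rr'.
have ur := uC _ rC; have ur' := uC _ r'C.
apply: k_loc; rewrite ?imset_f ?card_imset_used // -imset_usedI //.
by rewrite card_imset_used // => v /setIP[/ur].
Qed.

End Relabel.

Section Invariants.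
Variable L : Type.
Implicit Types (K : labelled_complex L) (a b c : L).

(** With [a = b] these are the faces of a single part, so that parts and their intersections are
    treated alike. *)
Definition common_faces K a b := faces (cells K a) :&: faces (cells K b).

Lemma cells_used K a : family_used (@vertex_used L K) (faces (cells K a)).
Proof.
move=> r /facesP[t tK /subsetP rt] v /rt vt.
by exists a; apply/bigcupP; exists t.
Qed.

Lemma common_faces_used K a b :
  family_used (@vertex_used L K) (common_faces K a b).
Proof. by move=> r /setIP[/cells_used]. Qed.

Lemma common_faces_star K (s : {set lvertex K}) a b : (1 < #|s|)%N ->
  common_faces (stellar_subdivision s) a b = star s (common_faces K a b).
Proof. by move=> s1; rewrite /common_faces /= !faces_star // starI. Qed.

Lemma common_faces_relabel K K' (f : lvertex K -> lvertex K') a b :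
    (forall u v, vertex_used u -> vertex_used v -> f u = f v -> u = v) ->
    (forall l, cells K' l = [set f @: (t :
      {set lvertex K}) | t in cells K l]) ->
  common_faces K' a b = relabel f (common_faces K a b).
Proof.
move=> f_inj K'E; rewrite /common_faces (relabelI f_inj); try exact: cells_used.
by rewrite !K'E -!faces_relabel.
Qed.

Lemma comb_alt_sum K K' a b : comb_equivalent K K' ->
  alt_sum (common_faces K a b) = alt_sum (common_faces K' a b).
Proof.
elim=> {K K'} [K K' f f_inj K'E|K s s1|K K' _ ->|K K' K'' _ -> _ ->] //.
  rewrite (common_faces_relabel a b f_inj K'E) (alt_sum_relabel f_inj) //.
  exact: common_faces_used.
by rewrite common_faces_star // alt_sum_star.
Qed.

Lemma comb_dim_le n K K' a b : comb_equivalent K K' ->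
  dim_le n (common_faces K a b) <-> dim_le n (common_faces K' a b).
Proof.
elim=> {K K'} [K K' f f_inj K'E|K s s1|K K' _ ->|K K' K'' _ -> _ ->] //.
  rewrite (common_faces_relabel a b f_inj K'E) (dim_le_relabel f_inj) //.
  exact: common_faces_used.
by rewrite common_faces_star // dim_le_star.
Qed.

Lemma comb_subset K K' a b c d : comb_equivalent K K' ->
  (common_faces K a b \subset common_faces K c d) =
  (common_faces K' a b \subset common_faces K' c d).
Proof.
elim=> {K K'} [K K' f f_inj K'E|K s s1|K K' _ ->|K K' K'' _ -> _ ->] //.
  rewrite !(common_faces_relabel _ _ f_inj K'E) (relabel_subset f_inj) //;
    exact: common_faces_used.
by rewrite !common_faces_star // star_subset.
Qed.

Lemma comb_linked n K K' a b : comb_equivalent K K' ->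
  dim_le n.+1 (common_faces K' a b) ->
  linked n (common_faces K a b) <-> linked n (common_faces K' a b).
Proof.
(* The dimension bound must accompany the induction, since a starring move preserves linkedness
   under it; it is itself invariant. *)
move=> KK'; rewrite -(comb_dim_le _ _ _ KK').
elim: KK' => {K K'} [K K' f f_inj K'E|K s s1|K K' KK' IH|K K' K'' KK' IH _ IH']
  // dimK.
- rewrite (common_faces_relabel a b f_inj K'E) (linked_relabel f_inj) //.
  exact: common_faces_used.
- by rewrite common_faces_star // linked_star.
- by rewrite IH // (comb_dim_le _ _ _ KK').
- by rewrite IH // IH' // -(comb_dim_le _ _ _ KK').
Qed.

End Invariants.

(** * The standard neck *)

Section ListedFaces.
Variable V : finType.
Implicit Types (s : seq V) (S : seq (seq V)) (r : {set V}).

(** Simplices are listed as sequences of vertices, so that questions about the prism can be settled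
    by evaluation. *)
Definition faces_seq S : {set {set V}} :=
  [set r : {set V} | has (fun s : seq V => r \subset s) S].
Definition meet s s' := [seq x <- s | x \in s'].

(** Discarding a simplex contained in one that is kept leaves the faces unchanged and keeps the
    branching inclusion-exclusion short. *)
Definition prune S := foldr (fun s S' =>
  if has (fun s' => all (mem s') s) S' then S' else s :: S') [::] S.

(* Inclusion-exclusion, one simplex at a time. *)
Fixpoint alt_sum_seq fuel S : int :=
  if fuel is n.+1 then if S is s :: S' then
    (s == [::])%:R + alt_sum_seq n S' - alt_sum_seq n (prune (map (meet s) S'))
  else 0 else 0.

Lemma sub_meet r s s' : (r \subset meet s s') = (r \subset s) && (r \subset s').
Proof.
apply/subsetP/andP=> [rs|[/subsetP rs /subsetP rs'] x xr]; last first.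
  by rewrite mem_filter rs' ?rs.
by split; apply/subsetP=> x /rs; rewrite mem_filter => /andP[].
Qed.

Lemma faces_seqI S S' :
  faces_seq S :&: faces_seq S' = faces_seq [seq meet s s' | s <- S, s' <- S'].
Proof.
apply/setP=> r; rewrite !inE; apply/andP/hasP.
  case=> /hasP[s sS rs] /hasP[s' s'S rs']; exists (meet s s');
    last by rewrite sub_meet rs.
  by apply/allpairsP; exists (s, s').
case=> _ /allpairsP[[s s'] [/= sS s'S ->]]; rewrite sub_meet => /andP[rs rs'].
by split; apply/hasP; [exists s | exists s'].
Qed.

Lemma faces_seq_subset S S' :
  all (fun s => has (fun s' => all (mem s') s) S') S ->
    faces_seq S \subset faces_seq S'.
Proof.
move=> /allP SS'; apply/subsetP=> r;
  rewrite !inE => /hasP[s /SS' /hasP[s' s'S /allP ss'] rs].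
by apply/hasP; exists s' => //; apply/subsetP=> x /(subsetP rs)/ss'.
Qed.

Lemma faces_seq_prune S : faces_seq (prune S) = faces_seq S.
Proof.
elim: S => //= s S IH; apply/setP=> r; rewrite [in RHS]inE /=.
have -> : has (fun s' : seq V =>
  r \subset s') S = (r \in faces_seq S) by rewrite inE.
rewrite -IH; case: ifP => [/hasP[s' s'S /allP ss']|_]; last by rewrite !inE.
apply/idP/orP => [|[rs|//]]; first by right.
by rewrite inE; apply/hasP; exists s' => //;
  apply/subsetP=> x /(subsetP rs)/ss'.
Qed.

Lemma size_prune S : (size (prune S) <= size S)%N.
Proof. by elim: S => //= s S IH; case: ifP => //= _; apply: leqW. Qed.

Lemma alt_sum_simplex s : alt_sum (faces_seq [:: s]) = (s == [::])%:R.
Proof.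
case: s => [|v s] /=.
  rewrite /alt_sum (big_pred1 set0) ?cards0 // => r.
  rewrite inE /= orbF; apply/idP/eqP=> [|->]; last by apply/subsetP=> x;
    rewrite inE.
  move=> r0; apply/setP=> x; rewrite inE; apply: contraTF r0 => xr.
  by apply/subsetPn; exists x.
rewrite /alt_sum; apply: (alt_sum_toggle (v := v)) => r.
rewrite !inE /= !orbF; apply/subsetP/subsetP=> rs x.
  by move=> xr; apply: rs; rewrite inE xr orbT.
by rewrite in_setU1 => /predU1P[->|/rs//]; rewrite inE eqxx.
Qed.

Lemma alt_sum_cons s S : alt_sum (faces_seq (s :: S)) =
  (s == [::])%:R + alt_sum (faces_seq S) - alt_sum (faces_seq (map (meet s) S)).
Proof.
have -> : faces_seq (s :: S) = faces_seq [:: s] :|: faces_seq S.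
  by apply/setP=> r; rewrite !inE /= orbF.
rewrite alt_sumU faces_seqI alt_sum_simplex; congr (_ - alt_sum (faces_seq _)).
by rewrite /= cats0.
Qed.

Lemma alt_sum_seqE fuel S : (size S <= fuel)%N ->
  alt_sum (faces_seq S) = alt_sum_seq fuel S.
Proof.
elim: fuel S => [|n IH] [|s S] //= nS; try by rewrite /alt_sum big1 // => r;
  rewrite inE.
rewrite alt_sum_cons IH // -(faces_seq_prune (map _ _)) [in X in _ - X]IH //.
by apply: leq_trans (size_prune _) _; rewrite size_map.
Qed.

Lemma dim_le_seq n S : all (fun s => size s <= n)%N S -> dim_le n (faces_seq S).
Proof.
move=> /allP Sn r; rewrite inE => /hasP[s /Sn sn rs].
exact: leq_trans (subset_leq_card rs) (leq_trans (card_size s) sn).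
Qed.

(** The simplices of full dimension form a gallery in the order of the list, each sharing [n]
    vertices with the next, so a locally constant function keeps its value along the list. *)
Lemma linked_seq n S : all (fun s => uniq s && (size s <= n.+1)%N) S ->
  sorted (fun s s' => n <= size (meet s s'))%N [seq s <- S | size s == n.+1] ->
  linked n (faces_seq S).
Proof.
move=> /allP Sn; set top := [seq s <- S | _] => sortS k k_loc.
have in_top r : r \in faces_seq S -> #|r| = n.+1 ->
    exists2 s, s \in top & r = [set x in s].
  rewrite inE => /hasP[s sS rs] cr; have /andP[us sn] := Sn s sS.
  have cs : #|[set x in s]| = size s by rewrite cardsE; apply/card_uniqP.
  have rs' : r \subset [set x in s] by apply/subsetP=> x /(subsetP rs);
    rewrite inE.
  exists s; last by apply/eqP; rewrite eqEcard rs' cs cr.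
  by rewrite mem_filter sS andbT eqn_leq sn -cr -cs subset_leq_card.
have top_in s : s \in top ->
    [/\ [set x in s] \in faces_seq S, uniq s & #|[set x in s]| = n.+1].
  rewrite mem_filter => /andP[/eqP cs sS]; have /andP[us _] := Sn s sS;
    split=> //.
    by rewrite inE; apply/hasP; exists s => //; apply/subsetP=> x; rewrite inE.
  by rewrite cardsE -cs; apply/card_uniqP.
have k_sorted : sorted (fun s s' => k [set x in s] == k [set x in s'])
    top.
  apply: (@sub_in_sorted _ (mem top) _ _ _ _ (allss _) sortS).
  move=> s s' /top_in[sS us cs] /top_in[s'S _ cs'] ss'.
  apply/eqP/k_loc => //; have ->
    : [set x in s] :&: [set x in s'] = [set x in meet s s'].
    by apply/setP=> x; rewrite !inE mem_filter andbC.
  by rewrite cardsE (card_uniqP _) ?filter_uniq.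
have k_const s s' : s \in top ->
    s' \in top -> k [set x in s] = k [set x in s'].
  case: top {sortS in_top top_in} k_sorted => // s0 S0 /= /order_path_min kS.
  have {}kS q : q \in s0 :: S0 -> k [set x in q] = k [set x in s0].
    rewrite inE => /predU1P[->//|qS]; apply/esym/eqP.
    have /allP := kS (fun x y z xy yz => introT eqP (etrans (eqP xy) (eqP yz))).
    by apply.
  by move=> /kS -> /kS ->.
by move=> t t' /in_top tS /in_top t'S /tS[s sS ->] /t'S[s' s'S ->];
  apply: k_const.
Qed.

End ListedFaces.

Lemma faces_listed (V : finType) (T : {set {set V}}) (S : seq (seq V)) :
  (forall t, t \in T <-> exists2 s, s \in S & t = [set x in s]) ->
  faces T = faces_seq S.
Proof.
move=> TS; apply/setP=> r; rewrite [RHS]inE; apply/facesP/hasP.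
  case=> t /TS[s sS ->] /subsetP rt; exists s => //.
  by apply/subsetP=> x /rt; rewrite inE.
case=> s sS /subsetP rs; exists [set x in s]; first by apply/TS; exists s.
by apply/subsetP=> x /rs; rewrite inE.
Qed.

Definition ord3 : seq 'I_3 := [:: @Ordinal 3 0 isT; @Ordinal 3 1 isT;
  @Ordinal 3 2 isT].

Definition level_seq h : seq (seq ('I_3 * 'I_3)) :=
  [:: [seq (h, j) | j <- ord3]].
(** The order matters for [linked_seq]: the triangles go round the band, each sharing an edge with
    the next. *)
Definition band_seq h k : seq (seq ('I_3 * 'I_3)) :=
  flatten [seq [:: [:: (h, j); (h, j + 1); (k, j)]; [:: (h, j + 1); (k, j);
    (k, j + 1)]]
    | j <- ord3].

Definition neck_seq (r : neck_part) : seq (seq ('I_3 * 'I_3)) :=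
  let o0 := @Ordinal 3 0 isT in let o1 := @Ordinal 3 1 isT in let o2 :=
    @Ordinal 3 2 isT in
  match r with
  | TopCap => level_seq o2
  | TopTube => band_seq o1 o2
  | MiddleDisk => level_seq o1
  | BottomTube => band_seq o0 o1
  | BottomCap => level_seq o0
  end.

Lemma mem_ord3 (j : 'I_3) : j \in ord3.
Proof. by case: j => -[|[|[|//]]] ?. Qed.

Lemma faces_level h : faces [set level h] = faces_seq (level_seq h).
Proof.
apply: faces_listed => t; rewrite inE; split.
  move/eqP->; exists [seq (h, j) | j <- ord3]; first by rewrite inE.
  apply/setP=> x; rewrite inE; apply/imsetP/mapP => -[j _ ->]; exists j => //.
  exact: mem_ord3.
case=> s; rewrite inE => /eqP -> ->; apply/eqP/setP=> x.
rewrite inE; apply/mapP/imsetP => -[j _ ->]; exists j => //.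
exact: mem_ord3.
Qed.

Lemma faces_band h k : faces (band h k) = faces_seq (band_seq h k).
Proof.
apply: faces_listed => t; rewrite inE; split.
  case/orP=> /imsetP[j _ ->].
    exists [:: (h, j); (h, j + 1); (k, j)]; last by apply/setP=> x;
      rewrite !inE orbA.
    by apply/flatten_mapP; exists j; rewrite ?mem_ord3 // !inE eqxx.
  exists [:: (h, j + 1); (k, j); (k, j + 1)]; last by apply/setP=> x;
    rewrite !inE orbA.
  by apply/flatten_mapP; exists j; rewrite ?mem_ord3 // !inE eqxx orbT.
case=> s /flatten_mapP[j _]; rewrite !inE => /orP[] /eqP-> ->; apply/orP;
  [left|right];
  by apply/imsetP; exists j => //; apply/setP=> x; rewrite !inE orbA.
Qed.

Definition neck_common a b :=
  prune [seq meet s s' | s <- neck_seq a, s' <- neck_seq b].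

Lemma common_faces_neck a b :
  common_faces standard_neck a b = faces_seq (neck_common a b).
Proof.
rewrite faces_seq_prune -faces_seqI /common_faces.
have faces_neck r : faces (cells standard_neck r) = faces_seq (neck_seq r).
  have inord0E : inord 0 = @Ordinal 3 0 isT by apply: val_inj;
    rewrite /= inordK.
  have inord1E : inord 1 = @Ordinal 3 1 isT by apply: val_inj;
    rewrite /= inordK.
  have inord2E : inord 2 = @Ordinal 3 2 isT by apply: val_inj;
    rewrite /= inordK.
  by case: r; rewrite /= ?inord0E ?inord1E ?inord2E ?faces_level ?faces_band.
by rewrite !faces_neck.
Qed.

(** * Properties of the neck read off from the prism *)

Section Neck.
Variables (V : finType) (N : neck_part -> {set {set V}}).
Hypothesis neckN : comb_equivalent (LabelledComplex N) standard_neck.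
Implicit Types (r e t : {set V}) (k : {set V} -> bool).

(** The fuel 100 is ample: a part of the prism has at most 6 triangles, so a list of meets has at
    most 36 entries. *)
Lemma neck_alt_sum a b :
  alt_sum (faces (N a) :&: faces (N b)) = alt_sum_seq 100 (neck_common a b).
Proof.
rewrite [LHS](comb_alt_sum a b neckN) common_faces_neck; apply: alt_sum_seqE.
by case: a b => -[]; vm_compute.
Qed.

Lemma neck_dim_le n a b : all (fun s => size s <= n)%N (neck_common a b) ->
  dim_le n (faces (N a) :&: faces (N b)).
Proof.
by move=> abn; apply/(comb_dim_le _ _ _ neckN); rewrite common_faces_neck;
  apply: dim_le_seq.
Qed.

Lemma neck_apart a b r : all (@nilp _) (neck_common a b) ->
  r \in faces (N a) -> r \in faces (N b) -> r = set0.
Proof.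
move=> ab ra rb; apply/eqP; rewrite -cards_eq0 -leqn0.
apply: (neck_dim_le (a := a) (b := b)); last by rewrite inE ra.
by apply: sub_all ab => s; rewrite /nilp leqn0.
Qed.

Lemma neck_subset a b c :
    all (fun s => has (fun s' =>
      all (mem s') s) (neck_common c c)) (neck_common a b) ->
  faces (N a) :&: faces (N b) \subset faces (N c).
Proof.
move=> abc; rewrite -[faces (N c)]setIid.
have -> := comb_subset a b c c neckN.
by rewrite !common_faces_neck faces_seq_subset.
Qed.

Lemma neck_linked n a b :
    all (fun s => uniq s && (size s <= n.+1)%N) (neck_common a b) ->
    sorted (fun s s' => n <= size (meet s s'))%N
      [seq s <- neck_common a b | size s == n.+1] ->
  linked n (faces (N a) :&: faces (N b)).
Proof.
move=> abn ab_sorted; apply/(comb_linked neckN); rewrite common_faces_neck.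
  by apply: dim_le_seq; apply: sub_all abn => s /andP[].
exact: linked_seq.
Qed.

(** Existence of an edge is the failure of a dimension bound, and the dimension bound is invariant:
    if top tube and disk shared no edge in [N], they would share none in the prism. *)
Lemma middle_circle_neq0 : exists e, e \in middle_circle N.
Proof.
have not_dim1 : ~ dim_le 1 (faces (N TopTube) :&: faces (N MiddleDisk)).
  move/(comb_dim_le _ TopTube MiddleDisk neckN).
  rewrite common_faces_neck => dim1.
  (* Evaluation shows that the first common face listed for the prism has two vertices. *)
  pose s : seq ('I_3 * 'I_3) := head [::] (neck_common TopTube MiddleDisk).
  have /dim1 : [set x in s] \in faces_seq (neck_common TopTube MiddleDisk).
    rewrite inE; apply/hasP; exists s; first by vm_compute.
    by apply/subsetP=> x; rewrite inE.
  by rewrite cardsE (card_uniqP _) //; vm_compute.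
have dim2 : dim_le 2 (faces (N TopTube) :&:
  faces (N MiddleDisk)) by apply: neck_dim_le; vm_compute.
have [/exists_inP[e eC e1]|/exists_inPn no_edge] :=
  boolP [exists e in faces (N TopTube) :&: faces (N MiddleDisk), (1 < #|e|)%N].
  have e2 := dim2 e eC; exists e; move: eC; rewrite !inE => /andP[-> ->] /=.
  by rewrite andbb eqn_leq e2.
by case: not_dim1 => e /no_edge; rewrite -leqNgt.
Qed.

End Neck.

(** * Euler characteristics and colorings *)

Section Euler.
Variable V : finType.
Implicit Types (A T X Y : {set {set V}}) (e r t : {set V}).

Lemma edgesP T e : reflect (#|e| = 2 /\ exists2 t,
  t \in T & e \subset t) (e \in edges T).
Proof.
rewrite inE; apply: (iffP andP) => [[/facesP Te /eqP]|[/eqP e2 Te]] //.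
by split=> //; apply/facesP.
Qed.

Lemma edges_faces T e : (e \in edges T) = (e \in faces T) && (#|e| == 2).
Proof. by rewrite inE. Qed.

(** The faces are sorted by cardinality, from 0 to 3; the empty one is present exactly when [T] is
    nonempty and accounts for the correction. *)
Lemma euler_alt_sum T : {in T, forall t : {set V}, #|t| = 3} ->
  euler T = (T != set0)%:R - alt_sum (faces T).
Proof.
move=> T3; have face_le3 r : r \in faces T -> (#|r| < 4)%N.
  by case/facesP=> t /T3 t3 /subset_leq_card; rewrite t3.
have -> : alt_sum (faces T) =
    \sum_(i < 4) (-1) ^+ i *+ #|[set r in faces T | #|r| == i]|.
  rewrite /alt_sum (partition_big (fun r : {set V} => inord #|r| :
    'I_4) predT) //=.
  apply: eq_bigr => i _; rewrite -sumr_const; apply: eq_big => r.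
    rewrite inE; case: (boolP (r \in _)) => //= rT.
    by rewrite -val_eqE /= inordK // face_le3.
  case/andP=> rT /eqP <-; by rewrite inordK // face_le3.
rewrite !big_ord_recl big_ord0 /= addr0 /bump /=.
have -> : [set r in faces T | #|r| == 3%N] = T.
  apply/setP=> r; rewrite inE; apply/andP/idP=> [[/facesP[t tT rt] r3]|rT].
    suff -> : r = t by [].
    by apply/eqP; rewrite eqEcard rt T3 // (eqP r3).
  by rewrite mem_faces // T3.
have -> : #|[set r in faces T | #|r| == 1%N]| = #|finset.cover T|.
  rewrite -(card_imset _ (@set1_inj V)); apply: eq_card => r; rewrite inE.
  apply/andP/imsetP=> [[/facesP[t tT rt] /cards1P[v rv]]|[v /bigcupP[t tT vt]
    ->]].
    by exists v => //; apply/bigcupP; exists t; rewrite // -sub1set -rv.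
  by rewrite cards1; split=> //; apply/facesP; exists t; rewrite ?sub1set.
have -> : #|[set r in faces T | #|r| == 0%N]| = (T != set0).
  have [->|/set0Pn[t tT]] /= := eqVneq T set0.
    by apply: eq_card0 => r; rewrite inE; case: facesP => // -[t]; rewrite inE.
  apply/eqP/cards1P; exists set0; apply/setP=> r; rewrite !inE cards_eq0.
  by case: eqP => [->|]; rewrite ?andbF // andbT; apply/exists_inP; exists t;
    rewrite ?sub0set.
rewrite /euler /edges !exprS expr0 !mulr1 !mulN1r !mulNrn opprK -![_%:Z]natz.
by move: #|_| #|_| #|_| (T != _) => v e f b; ring.
Qed.

(** Inclusion-exclusion, where [A] meets [X] and [Y] in the same faces. Being nonempty, [X] and [Y]
    both have the empty face, on which the last hypothesis is silent. *)
Lemma euler_replace A X Y :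
    {in A :|: X, forall t : {set V}, #|t| = 3} ->
    {in A :|: Y, forall t : {set V}, #|t| = 3} ->
    X != set0 -> Y != set0 ->
    (forall r, r != set0 -> r \in faces A ->
      (r \in faces X) = (r \in faces Y)) ->
  euler (A :|: X) + alt_sum (faces X) = euler (A :|: Y) + alt_sum (faces Y).
Proof.
move=> X3 Y3 X0 Y0 XY.
have neq0 Z : Z != set0 -> A :|: Z != set0.
  by move=> Z0; rewrite setU_eq0 negb_and Z0 orbT.
have faces0 Z : Z != set0 -> set0 \in faces Z.
  by case/set0Pn=> z zZ; apply/facesP; exists z; rewrite ?sub0set.
rewrite !euler_alt_sum // !facesU !alt_sumU !neq0 //.
have -> : faces A :&: faces X = faces A :&: faces Y.
  apply/setP=> r; rewrite !in_setI; have [->|r0] := eqVneq r set0;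
    first by rewrite (faces0 _ X) ?(faces0 _ Y).
  by case: (boolP (r \in faces A)) => //= /XY ->.
by ring.
Qed.

End Euler.

(** * Colorings as functions on triangles *)

Section Foam.
Variables (V : finType) (F : foam V).
Implicit Types (e t u : {set V}) (k : {set V} -> bool).
Implicit Types (c : {ffun thin_facet F -> color}).

(** The default is [false] off the thin triangles, so comparisons of colors are restricted to
    [thin F]. *)
Definition color_at c t := [exists f : thin_facet F, (t \in val f) && c f].

(** A facet-free form of a coloring: it constrains only pairs of thin triangles sharing an edge, and
    can therefore be checked piece by piece after cutting. *)
Definition thin_coloring k := forall e t t', #|e| = 2 ->
  t \in thin F -> t' \in thin F -> e \subset t -> e \subset t' -> t != t' ->
    (k t == k t') = (e \notin singular_edges F).

Definition make_coloring k : {ffun thin_facet F -> color} :=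
  [ffun f : thin_facet F => [exists t in val f, k t] : color].

Lemma mem_thin t : t \in thin F -> t \in triangles F.
Proof. by rewrite inE => ->. Qed.

Lemma singular_edge e t t' : #|e| = 2 -> t \in thin F -> t' \in Defs.double F ->
  e \subset t -> e \subset t' -> e \in singular_edges F.
Proof.
by move=> e2 tF t'F et et'; rewrite inE; apply/andP; split; apply/edgesP;
  split=> //;
  [exists t | exists t'].
Qed.

Lemma adjacent_sym : symmetric (adjacent (triangles F) (regular_edges F)).
Proof.
move=> t t'; rewrite /adjacent andbCA; congr (_ && (_ && _)).
by apply: eq_existsb => e; rewrite [X in _ && X]andbC.
Qed.

Let facet_sym : connect_sym (adjacent (triangles F) (regular_edges F)).
Proof. exact: sym_connect_sym adjacent_sym. Qed.

Lemma facet_eq t t' : t' \in facet F t -> facet F t' = facet F t.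
Proof.
rewrite inE => tt'; apply/setP=> u; rewrite !inE.
by rewrite -(same_connect facet_sym tt').
Qed.

(** An edge between a thin and a double triangle is singular, and facets do not cross singular
    edges. *)
Lemma adjacent_thin t t' : adjacent (triangles F) (regular_edges F) t t' ->
  (t \in thin F) = (t' \in thin F).
Proof.
have imp u u' : adjacent (triangles F) (regular_edges F) u u' -> u \in thin F ->
  u' \in thin F.
  case/and3P=> _ u'F /exists_inP[e]; rewrite inE => /andP[e_sing /edgesP[e2 _]].
  case/andP=> eu eu' uF; move: u'F; rewrite inE => /orP[//|u'F].
  by rewrite (singular_edge e2 uF u'F) in e_sing.
by move=> tt'; apply/idP/idP; apply: imp; rewrite // adjacent_sym.
Qed.

Lemma facet_thin t t' : t \in thin F -> t' \in facet F t -> t' \in thin F.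
Proof.
move=> tF; rewrite inE => tt'.
by rewrite -(closed_connect (a := mem (thin F)) adjacent_thin tt').
Qed.

Lemma thin_facetP (f : thin_facet F) :
  exists2 t, t \in thin F & val f = facet F t.
Proof. by case: f => f /= /imsetP[t tF ->]; exists t. Qed.

Lemma thin_facet_of t : t \in thin F -> exists f : thin_facet F, t \in val f.
Proof.
move=> tF; exists (exist _ (facet F t) (imset_f _ tF)).
by rewrite inE connect0.
Qed.

Lemma mem_thin_facet (f : thin_facet F) t : t \in val f ->
  t \in thin F /\ val f = facet F t.
Proof.
have [u uF ->] := thin_facetP f => tu.
by rewrite (facet_eq tu); split=> //; apply: facet_thin tu.
Qed.

Lemma thin_facet_inj (f g : thin_facet F) t : t \in val f -> t \in val g ->
  f = g.
Proof.
by move=> /mem_thin_facet[_ fE] /mem_thin_facet[_ gE]; apply: val_inj;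
  rewrite fE gE.
Qed.

Lemma color_atE c (f : thin_facet F) t : t \in val f -> color_at c t = c f.
Proof.
move=> tf; apply/existsP/idP => [[g /andP[tg]]|cf]; last by exists f;
  rewrite tf.
by rewrite (thin_facet_inj tf tg).
Qed.

Lemma color_at_inj c c' : {in thin F, color_at c =1 color_at c'} -> c = c'.
Proof.
move=> cc'; apply/ffunP=> f; have [t tF fE] := thin_facetP f.
have tf : t \in val f by rewrite fE inE connect0.
by rewrite -!(color_atE _ tf) cc'.
Qed.

Lemma eq_thin_coloring k k' : {in thin F, k =1 k'} -> thin_coloring k ->
  thin_coloring k'.
Proof. by move=> kk' kF e t t' e2 tF t'F; rewrite -!kk' //; apply: kF. Qed.

Lemma adjacentP t t' e : #|e| = 2 -> t \in triangles F -> t' \in triangles F ->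
  e \subset t -> e \subset t' -> e \notin singular_edges F ->
  adjacent (triangles F) (regular_edges F) t t'.
Proof.
move=> e2 tF t'F et et' e_reg; rewrite /adjacent tF t'F.
apply/exists_inP; exists e; rewrite ?et // inE e_reg; apply/edgesP.
by split=> //; exists t.
Qed.

(** Thin triangles sharing a regular edge lie in one facet and so agree in color; at singular edges
    the two conditions coincide. *)
Lemma is_coloringP c : is_coloring c <-> thin_coloring (color_at c).
Proof.
split=> [c_col e t t' e2 tF t'F et et' tt'|c_col].
  have [f tf] := thin_facet_of tF; have [g t'g] := thin_facet_of t'F.
  rewrite (color_atE _ tf) (color_atE _ t'g); have [e_sing|e_reg] /= :=
    boolP (e \in _).
    move/forall_inP: c_col => /(_ e e_sing)/forallP/(_ f)/forallP/(_ g).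
    move=> /forall_inP/(_ t tf)/forall_inP/(_ t' t'g).
    by rewrite et et' tt' => /negbTE.
  apply/eqP; congr (c _); apply: (thin_facet_inj tf).
  have [_ ->] := mem_thin_facet t'g; rewrite inE facet_sym; apply: connect1.
  by apply: adjacentP e_reg; rewrite ?mem_thin.
apply/forall_inP=> e e_sing; apply/forallP=> f; apply/forallP=> g.
apply/forall_inP=> t tf; apply/forall_inP=> t' t'g;
  apply/implyP=> /and3P[et et' tt'].
have [tF _] := mem_thin_facet tf; have [t'F _] := mem_thin_facet t'g.
rewrite -(color_atE c tf) -(color_atE c t'g) (c_col e) //;
  first by rewrite negbK.
by move: e_sing; rewrite inE => /andP[/edgesP[]].
Qed.

Lemma thin_coloring_facet k t t' : thin_coloring k -> t \in thin F ->
  t' \in facet F t ->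
  k t' = k t.
Proof.
move=> k_col tF; rewrite inE => tt'.
have k_closed : closed (adjacent (triangles F) (regular_edges F))
    [pred u | (u \in thin F) && (k u == k t)].
  move=> u u' uu'; rewrite !inE -(adjacent_thin uu').
  have [uF /=|//] := boolP (u \in thin F).
  have u'F : u' \in thin F by rewrite -(adjacent_thin uu').
  have [->//|uu'N] := eqVneq u u'.
  have /and3P[_ _ /exists_inP[e]] := uu'.
  rewrite inE => /andP[e_reg /edgesP[e2 _]] /andP[eu eu'].
  suff /eqP -> : k u == k u' by [].
  by rewrite (k_col e) // e_reg.
by have := closed_connect k_closed tt';
  rewrite !inE tF eqxx /= => /esym/andP[_ /eqP].
Qed.

Lemma make_coloringK k : thin_coloring k ->
  {in thin F, color_at (make_coloring k) =1 k}.
Proof.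
move=> k_col t tF; have [f tf] := thin_facet_of tF.
rewrite (color_atE _ tf) ffunE; have [_ fE] := mem_thin_facet tf.
apply/exists_inP/idP=> [[u]|kt]; last by exists t.
by rewrite fE => /(thin_coloring_facet k_col tF) ->.
Qed.

Lemma make_coloring_is_coloring k : thin_coloring k ->
  is_coloring (make_coloring k).
Proof.
move=> k_col; apply/is_coloringP; apply: (eq_thin_coloring _ k_col) => t tF.
by rewrite make_coloringK.
Qed.

Lemma surfaceE c i :
  surface c i = Defs.double F :|: [set t in thin F | color_at c t == i].
Proof.
congr (_ :|: _); apply/setP=> t; rewrite inE; apply/bigcupP/andP.
  by case=> f /eqP <- tf; rewrite (color_atE _ tf); have [-> _] :=
    mem_thin_facet tf.
case=> /thin_facet_of[f tf]; rewrite (color_atE _ tf) => cf.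
by exists f.
Qed.

(** Each thin triangle lies in exactly one facet, so the double sum over facets and their triangles
    collapses. *)
Lemma dots_of_colorE c i :
  dots_of_color c i = (\sum_(t in thin F | color_at c t == i) dots F t)%N.
Proof.
rewrite /dots_of_color (exchange_big_dep [pred t | (t \in thin F) &&
  (color_at c t == i)]) /=.
  apply: eq_bigr => t /andP[tF ct]; have [f tf] := thin_facet_of tF.
  rewrite (big_pred1 f) // => g; apply/andP/eqP => [[_ tg]|->];
    first exact: thin_facet_inj tg tf.
  by rewrite -(color_atE _ tf).
by move=> f t /eqP <- tf; rewrite (color_atE _ tf) eqxx andbT; have [] :=
  mem_thin_facet tf.
Qed.

End Foam.

(** Serves to count positive circles: [x] is the circle lost by cutting, [P] and [P'] are positivity
    before and after. *)
Lemma card_setU1_sat (T : finType) (S S' : {set T}) x (P P' : pred T) :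
    S = x |: S' -> x \notin S' -> {in S', P =1 P'} ->
  #|[set y in S | P y]| = (P x + #|[set y in S' | P' y]|)%N.
Proof.
move=> -> xS' PP'; rewrite (cardsD1 x) in_set setU11; congr (_ + _)%N.
apply: eq_card => y; rewrite !inE; have [->|_] /= := eqVneq y x.
  by rewrite (negPf xS').
by have [/PP'->|] := boolP (y \in S').
Qed.

(** * Positive circles *)

Section Positivity.
Variables (R : realType) (V : finType) (pos : V -> 'rV[R]_3).
Implicit Types (e t : {set V}).

Lemma edge_positiveE (F : foam V) (c : {ffun thin_facet F -> color}) e :
  edge_positive pos c e = [exists u, exists v, exists a, exists b, exists d,
   [&& e == [set u; v], a |: e \in thin F, b |: e \in thin F, d |:
     e \in Defs.double F,
       orient F (a |: e) u v, met_first (pos u) (pos v) (pos d) (pos a) (pos b)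
     & color_at c (a |: e)]].
Proof.
rewrite /edge_positive; do 5!apply: eq_existsb => ?.
apply/existsP/idP=> [[f /and5P[-> af -> -> /and3P[-> -> /eqP cf]]]|].
  by rewrite (color_atE _ af) cf; have [-> _] := mem_thin_facet af.
case/and5P=> -> /thin_facet_of[f af] -> -> /and3P[-> -> caf]; exists f.
by rewrite af -(color_atE _ af) caf.
Qed.

Lemma det3_swap (a b c : 'rV[R]_3) : det3 a c b = - det3 a b c.
Proof.
rewrite /det3; pose s := tperm (1 : 'I_3) (2 : 'I_3).
set A := (X in - \det X).
have -> : \matrix_(i < 3) [:: a; c; b]`_i = row_perm s A.
  apply/matrixP=> i j; rewrite !mxE /s; case: tpermP => [->|->|] //.
  by case: i => -[|[|[|//]]] iP // /eqP + /eqP.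
by rewrite row_permE det_mulmx det_perm odd_tperm /= expr1 mulN1r.
Qed.

Lemma ccw_asym (p q x y : 'rV[R]_3) : ccw p q x y -> ~~ ccw p q y x.
Proof.
by rewrite /ccw det3_swap oppr_lt0 -leNgt => /ltW.
Qed.

Lemma ccw_irr (p q x : 'rV[R]_3) : ccw p q x x = false.
Proof. by apply/negP=> xx; have := ccw_asym xx; rewrite xx. Qed.

Lemma met_first_neq (p q d a b : 'rV[R]_3) : met_first p q d a b -> a <> b.
Proof.
move=> + ab; rewrite /met_first ab ccw_irr andbF /= => /andP[/ccw_asym/negPf->].
by [].
Qed.

(** Either order asserts two of the three successive turns, in opposite senses; two pairs out of
    three share a turn, which would then go both ways. *)
Lemma met_first_asym (p q d a b : 'rV[R]_3) : met_first p q d a b ->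
  ~~ met_first p q d b a.
Proof.
rewrite /met_first; apply: contraL.
by case/or3P=> /andP[/ccw_asym/negPf-> /ccw_asym/negPf->]; rewrite ?andbF.
Qed.

(* The orientations of the three triangles force the same direction of the edge,
   and the two thin triangles exchange their roles. *)
Lemma edge_positive_swap (F : foam V) (c c' : {ffun thin_facet F -> color}) e :
    is_foam F pos -> e \in singular_edges F ->
    {in thin F, forall t, color_at c' t = ~~ color_at c t} ->
  edge_positive pos c e -> ~~ edge_positive pos c' e.
Proof.
move=> foamF e_sing cc'; have tri3 t : t \in triangles F -> #|t| = 3.
  by case: (foam_embedded foamF) => T3 _ /T3[].
move: (e_sing); rewrite inE =>
  /andP[/edgesP[e2 [t0 t0F et0]] /edgesP[_ [d0 d0F ed0]]].
have := foam_edges foamF (e := e).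
have -> : e \in edges (triangles F) by apply/edgesP; split=> //; exists t0;
  rewrite // inE t0F.
set T := [set _ in thin F | _]; set D :=
  [set _ in Defs.double F | _] => /(_ isT) count.
(* Of the three local models at an edge, only the one with two thin triangles and one double
   triangle has both kinds. *)
have [T2 D1] : #|T| = 2 /\ #|D| = 1.
  have T_gt0 : (0 < #|T|)%N by apply/card_gt0P; exists t0; rewrite inE t0F.
  have D_gt0 : (0 < #|D|)%N by apply/card_gt0P; exists d0; rewrite inE d0F.
  by move: count; rewrite !inE => /or3P[] /eqP[cT cD];
    rewrite ?cT ?cD in T_gt0 D_gt0 *.
have apex x : (x |: e) \in triangles F -> x \notin e.
  by move/tri3; rewrite cardsU1 e2; case: (x \in e).
have apex_inj x y : (x |: e) \in triangles F -> x |: e = y |: e -> x = y.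
  by move=> /apex xe xy; have := setU11 x e;
    rewrite xy in_setU1 (negPf xe) orbF => /eqP.
rewrite !edge_positiveE.
case/existsP=> u /existsP[v /existsP[a /existsP[b /existsP[d]]]].
case/and5P=> /eqP eE aF bF dF /and3P[a_or abd ca].
apply/negP; case/existsP=>
  u' /existsP[v' /existsP[a' /existsP[b' /existsP[d']]]].
case/and5P=> /eqP eE' a'F b'F d'F /and3P[a'_or a'b'd' ca'].
have uv : u != v by move: e2; rewrite eE cards2; case: eqP.
have thin_tri x : x |: e \in thin F -> x |: e \in triangles F by move=> xF;
  rewrite inE xF.
have double_tri x : x |: e \in Defs.double F -> x |: e \in triangles F.
  by move=> xF; rewrite inE xF orbT.
have ab : a <> b by move=> abE; apply: (met_first_neq abd); rewrite abE.
have thin_apex x : x |: e \in thin F -> x = a \/ x = b.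
  move=> xF; have : [set x |: e; a |: e; b |: e] \subset T.
    by apply/subsetP=> y; rewrite !inE => /orP[/orP[]|] /eqP->;
      rewrite ?xF ?aF ?bF subsetUr.
  move/subset_leq_card; rewrite T2 -setUA cardsU1 cards2 !inE negb_or.
  have -> : a |: e != b |: e by apply/eqP=> abE; apply: ab;
    exact: (apex_inj _ _ (thin_tri _ aF) abE).
  have [xa|_] := eqVneq (x |: e) (a |: e).
    by left; apply: apex_inj (thin_tri _ xF) xa.
  have [xb|//] := eqVneq (x |: e) (b |: e).
  by right; apply: apex_inj (thin_tri _ xF) xb.
(* Only two thin triangles contain [e], and the one marked by [c'] must have color 2 under [c]. *)
have a'b : a' = b.
  by case: (thin_apex a' a'F) => // a'a; move: ca'; rewrite cc' // a'a ca.
have b'a : b' = a.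
  case: (thin_apex b' b'F) => // b'b; case: (met_first_neq a'b'd').
  by rewrite a'b b'b.
have d'd : d' = d.
  apply: (apex_inj _ _ (double_tri _ d'F)).
  have /cards1P[t DE] : #|D| == 1 by rewrite D1.
  have : d' |: e \in D by rewrite inE d'F subsetUr.
  have : d |: e \in D by rewrite inE dF subsetUr.
  by rewrite DE !inE => /eqP -> /eqP.
(* Coherence is available between a thin and the double triangle only, so it is applied twice: from
   [a] to [d], then from [d] to [b]. *)
have b_or : orient F (b |: e) u v.
  have thin_double x y : x |: e \in thin F -> y |: e \in Defs.double F ->
      x |: e != y |: e /\ (x |: e \in thin F) != (y |: e \in thin F).
    move=> xF yF; have := disjointFl (foam_types foamF) yF => yT.
    by rewrite xF yT; split=> //; apply: contraTneq xF => ->; rewrite yT.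
  have [ad_neq ad_thin] := thin_double _ _ aF dF.
  have [bd_neq bd_thin] := thin_double _ _ bF dF.
  have d_or : orient F (d |: e) v u.
    apply: (foam_coherent foamF) a_or; rewrite -?eE ?subsetUr //.
    - exact: thin_tri.
    - exact: double_tri.
  apply: (foam_coherent foamF) d_or; rewrite 1?[[set v;
    u]]setUC -?eE ?subsetUr //.
  - exact: double_tri.
  - exact: thin_tri.
  - by rewrite eq_sym.
  - by rewrite eq_sym.
  - by rewrite eq_sym.
(* The boundary of [b |: e] is a directed 3-cycle, which traverses each of its edges in one
   direction only. *)
have [u'u v'v] : u' = u /\ v' = v.
  have [p [q [r [bE b_orE]]]] := foam_oriented foamF (thin_tri _ bF).
  have : #|[set p; q; r]| = 3 by rewrite -bE tri3 // thin_tri.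
  rewrite setUC cardsU1 cards2 !inE => pqr.
  have [/negPf pq /negPf rp /negPf rq] : [/\ p != q, r != p & r != q].
    by move: pqr; do 3!case: eqP => //=.
  have [u'e v'e] : u' \in [set u; v] /\ v' \in [set u; v].
    by rewrite -eE eE' !inE !eqxx orbT.
  have u'v' : u' != v' by move: e2; rewrite eE' cards2; case: eqP.
  move: u'e v'e; rewrite !inE => /orP[] /eqP u'E /orP[] /eqP v'E; move: u'v';
    rewrite u'E v'E ?eqxx // => _.
  move: a'_or b_or; rewrite a'b u'E v'E !b_orE !inE /=.
  have neq := (pq, rp, rq, etrans (eq_sym _ _) pq, etrans (eq_sym _ _) rp,
    etrans (eq_sym _ _) rq).
  by move=> /or3P[] /eqP[-> ->]; rewrite !xpair_eqE !neq ?andbF.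
move: a'b'd'; rewrite a'b b'a d'd u'u v'v => bad.
by have := met_first_asym abd; rewrite bad.
Qed.

End Positivity.

(** * The algebra of a colored evaluation *)

Section EvaluationForm.
Variables (A : comUnitRingType) (y1 y2 q12 q21 : A).
Hypothesis y12_unit : y1 - y2 \is a GRing.unit.

Let half (z : int) := (z %/ 2)%Z.

(** The colored evaluation as a function of its numerical data, over any ring in which [y1 - y2] is
    a unit; the comparison becomes arithmetic of these data. *)
Definition eval_form (theta : nat) (chi1 chi2 chi12 : int) (d1 d2 : nat) : A :=
  (-1) ^ (theta%:Z + half chi2)
  * (y1 ^+ d1 * y2 ^+ d2 * q12 ^ half chi1 * q21 ^ half chi2 / (y1 - y2) ^ half
    chi12).

Lemma eval_form_theta theta chi1 chi2 chi12 d1 d2 :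
  eval_form (1 + theta) chi1 chi2 chi12 d1 d2 = - eval_form theta chi1 chi2
    chi12 d1 d2.
Proof.
rewrite /eval_form PoszD -addrA [in LHS]exprzDr ?unitrN1 //.
by rewrite -exprnP expr1 mulN1r mulNr.
Qed.

Lemma eval_form_dots theta chi1 chi2 chi12 d1 d2 :
  eval_form theta chi1 chi2 chi12 d1 d2 =
  eval_form theta chi1 chi2 (chi12 + 2) (d1 + 1) d2
  - eval_form theta chi1 chi2 (chi12 + 2) d1 (d2 + 1).
Proof.
(* Adding 2 before the integer division by 2 adds exactly 1 after it, for every integer. *)
have halfE : half (chi12 + 2) = half chi12 + 1.
  by rewrite /half -[X in chi12 + X]mul1r addrC divzMDl // addrC.
rewrite /eval_form halfE (exprzDr y12_unit) expr1z invrM ?unitrXz ?y12_unit //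
  !exprD !expr1.
rewrite -mulrBr; congr (_ * _).
set u := (y1 - y2)^-1; set w := _^-1; set s := q12 ^ _; set r := q21 ^ _.
have yu : (y1 - y2) * u = 1 by apply: divrr.
transitivity (y1 ^+ d1 * y2 ^+ d2 * s * r * ((y1 - y2) * u) * w);
  first by rewrite yu mulr1.
by ring.
Qed.

End EvaluationForm.

(** * The effect of one dot *)

Section AddDot.
Variables (R : realType) (V : finType) (pos : V -> 'rV[R]_3) (F : foam V).
Variables (t : {set V}) (c : {ffun thin_facet F -> color}).
Hypothesis tF : t \in thin F.

(** [add_dot] changes only the dot function, so the facets are the same by conversion and [c] serves
    as a coloring of both foams. *)
Lemma dots_of_color_add_dot i :
  @dots_of_color V (add_dot F t) c i = (dots_of_color c i + (color_at c t ==
    i))%N.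
Proof.
rewrite [LHS]dots_of_colorE [in RHS]dots_of_colorE.
rewrite [LHS](_ : _ = \sum_(u in thin F | color_at c u == i) (dots F u + (u ==
  t)))%N //.
rewrite big_split /=; congr (_ + _)%N.
have [ct|ct] := boolP (color_at c t == i).
  rewrite (bigD1 t) ?tF //= eqxx big1 ?addn0 // => u /andP[_ /negPf ->] //.
rewrite big1 // => u /andP[uF cu]; apply/eqP; rewrite eqb0.
by apply: contraNneq ct => <-.
Qed.

Lemma color_evaluation_add_dot :
  @color_evaluation V (add_dot F t) R pos c =
  eval_form x1 x2 p12 p21 (theta_plus pos c) (euler (surface c true))
    (euler (surface c false)) (euler (thin F))
    (dots_of_color c true + color_at c t) (dots_of_color c false + ~~ color_at
      c t).
Proof.
have -> : (dots_of_color c true + color_at c t)%N = @dots_of_color V (add_dot F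
  t) c true.
  by rewrite dots_of_color_add_dot eqb_id.
have -> : (dots_of_color c false + ~~ color_at c t)%N = @dots_of_color V
  (add_dot F t) c false.
  by rewrite dots_of_color_add_dot eqbF_neg.
by [].
Qed.

End AddDot.

(** * Cutting the neck *)

Section NeckCut.
Variables (R : realType) (V : finType) (pos : V -> 'rV[R]_3).
Variables (F F' : foam V) (N : neck_part -> {set {set V}}).
Hypothesis foamF : is_foam F pos.
Hypothesis cutF : neck_cut pos F F' N.
Implicit Types (e r t u : {set V}) (b : bool) (k : {set V} -> bool).

(** Here [true] is the top and [false] the bottom; negation exchanges the ends, so one argument
    covers both. *)
Definition tube_part b := if b then TopTube else BottomTube.
Definition cap_part b := if b then TopCap else BottomCap.
Let tube := N TopTube :|: N BottomTube.
Let caps := N TopCap :|: N BottomCap.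
Let rest := triangles F :\: (tube :|: N MiddleDisk).
Let neckN := cut_neck cutF.

Lemma card_triangle t : t \in triangles F :|: triangles F' -> #|t| = 3.
Proof. by case: (cut_embedded cutF) => T3 _ /T3[]. Qed.

Lemma in_tube t : (t \in tube) = [exists b, t \in N (tube_part b)].
Proof.
rewrite in_setU; apply/orP/existsP=> [[?|?]|[[] ?]];
  [by exists true|by exists false|by left|by right].
Qed.

Lemma in_caps t : (t \in caps) = [exists b, t \in N (cap_part b)].
Proof.
rewrite in_setU; apply/orP/existsP=> [[?|?]|[[] ?]];
  [by exists true|by exists false|by left|by right].
Qed.

Lemma tube_thin b t : t \in N (tube_part b) -> t \in thin F.
Proof.
by move=> tb; apply: (subsetP (cut_tube_thin cutF)); rewrite in_tube;
  apply/existsP; exists b.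
Qed.

Lemma middle_double t : t \in N MiddleDisk -> t \in Defs.double F.
Proof. exact: (subsetP (cut_disk_double cutF)). Qed.

Lemma thin_not_double t : t \in thin F -> t \notin Defs.double F.
Proof. by move/(disjointFr (foam_types foamF)) ->. Qed.

Lemma cap_thin b t : t \in N (cap_part b) -> t \in thin F'.
Proof.
move=> tb; rewrite (cut_thin cutF) in_setU; apply/orP; right.
by rewrite in_caps; apply/existsP; exists b.
Qed.

Lemma rest_thin t : (t \in thin F :\: tube) = (t \in thin F) && (t \in rest).
Proof.
rewrite !inE; case: (boolP (t \in thin F)) => tF; rewrite ?andbF //= !andbT.
have /negbTE -> : t \notin N MiddleDisk.
  by apply: contra (thin_not_double tF); apply: middle_double.
by rewrite orbF.
Qed.

Lemma rest_double t :
  (t \in Defs.double F') = (t \in Defs.double F) && (t \in rest).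
Proof.
rewrite (cut_double cutF) !inE.
case: (boolP (t \in Defs.double F)) => tF; rewrite ?andbF //= !orbT !andbT.
have -> : (t \in N TopTube) || (t \in N BottomTube) = false.
  by apply/negbTE; rewrite -in_setU;
    apply: contraL tF => /(subsetP (cut_tube_thin cutF))/thin_not_double.
by [].
Qed.

Lemma thin'P t : reflect
  (t \in thin F :\: tube \/ exists b, t \in N (cap_part b)) (t \in thin F').
Proof.
rewrite (cut_thin cutF) in_setU; apply: (iffP orP) => -[?|]; try by left.
  by rewrite -/caps in_caps => /existsP; right.
by move=> ?; right; rewrite -/caps in_caps; apply/existsP.
Qed.

Lemma thinP t : t \in thin F ->
  t \in thin F :\: tube \/ exists b, t \in N (tube_part b).
Proof.
move=> tF; case: (boolP (t \in tube)) => [|tt]; last by left;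
  rewrite in_setD tt.
by rewrite in_tube => /existsP; right.
Qed.

Lemma rest_thin_mem t : t \in thin F :\: tube -> t \in rest.
Proof. by rewrite rest_thin => /andP[]. Qed.

Lemma card_rest t : t \in rest -> #|t| = 3.
Proof. by rewrite inE => /andP[_ tF]; apply: card_triangle; rewrite inE tF. Qed.

Lemma card_tube b t : t \in N (tube_part b) -> #|t| = 3.
Proof. by move/tube_thin=> tF; apply: card_triangle; rewrite !inE tF. Qed.

Lemma card_cap b t : t \in N (cap_part b) -> #|t| = 3.
Proof. by move/cap_thin=> tF; apply: card_triangle; rewrite !inE tF !orbT. Qed.

(** The form in which [cut_rest] is applied: a face that the rest shares with any part of the neck
    lies on an end circle, hence on a half tube and on its cap. *)
Lemma rest_neck r l : r \in faces rest -> r \in faces (N l) ->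
  exists b, r \in faces (N (tube_part b)) /\ r \in faces (N (cap_part b)).
Proof.
move=> r_rest rl; have := subsetP (cut_rest cutF) r.
rewrite in_setI -/tube -/caps -/rest r_rest !facesU.
have -> : r \in faces (N TopTube) :|: faces (N BottomTube) :|:
  faces (N MiddleDisk)
    :|: (faces (N TopCap) :|: faces (N BottomCap)).
  by rewrite !in_setU; case: l rl => ->; rewrite ?orbT.
by move=> /(_ isT)/setUP[] /setIP[rt rc]; [exists true | exists false].
Qed.

Lemma caps_apart b r : r \in faces (N (cap_part b)) ->
  r \in faces (N (cap_part (~~ b))) -> r = set0.
Proof. by case: b; apply: (neck_apart neckN); vm_compute. Qed.

Lemma cap_tube_apart b r :
  r \in faces (N (cap_part b)) -> r \in faces (N (tube_part (~~ b))) ->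
    r = set0.
Proof. by case: b; apply: (neck_apart neckN); vm_compute. Qed.

Lemma cap_middle_apart b r : r \in faces (N (cap_part b)) ->
  r \in faces (N MiddleDisk) -> r = set0.
Proof. by case: b; apply: (neck_apart neckN); vm_compute. Qed.

(** The two half tubes and the disk meet pairwise in the same circle; both inclusions hold on the
    prism. *)
Lemma tube_middle b r : r \in faces (N (tube_part b)) ->
  (r \in faces (N (tube_part (~~ b)))) = (r \in faces (N MiddleDisk)).
Proof.
move=> rb; apply/idP/idP=> rx.
  have : r \in faces (N (tube_part b)) :&:
    faces (N (tube_part (~~ b))) by rewrite inE rb.
  by apply/subsetP; case: b {rb rx}; apply: (neck_subset neckN); vm_compute.
have : r \in faces (N (tube_part b)) :&: faces (N MiddleDisk) by rewrite inE rb.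
by apply/subsetP; case: b {rb rx}; apply: (neck_subset neckN); vm_compute.
Qed.

Lemma middle_circleP b e : reflect
  [/\ #|e| = 2, e \in faces (N (tube_part b)) & e \in faces (N MiddleDisk)] (e
    \in middle_circle N).
Proof.
rewrite in_setI !edges_faces; apply: (iffP andP) =>
  [[/andP[et /eqP e2] /andP[em _]]|[e2 et em]].
  by split=> //; case: b; rewrite // -(tube_middle (b := true)) // in em.
rewrite em e2 !andbT; split=> //.
by case: b et => // et; rewrite (tube_middle (b := false)).
Qed.

Lemma tubes_disjoint b t : t \in N (tube_part b) ->
  t \notin N (tube_part (~~ b)).
Proof.
move=> tb; apply/negP=> tb'; suff : (#|t| <= 2)%N by rewrite (card_tube tb).
have dim2 : dim_le 2 (faces (N (tube_part b)) :&: faces (N (tube_part (~~ b)))).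
  by case: b {tb tb'}; apply: (neck_dim_le neckN); vm_compute.
by apply: dim2; rewrite inE !mem_faces.
Qed.

(** * Singular edges before and after cutting *)

Lemma card2_neq0 e : #|e| = 2 -> e <> set0.
Proof. by move=> e2 e0; rewrite e0 cards0 in e2. Qed.

Lemma face_mem (S : {set {set V}}) t e : t \in S -> e \subset t ->
  e \in faces S.
Proof. by move=> tS et; apply/facesP; exists t. Qed.

Lemma singular_card e : e \in singular_edges F -> #|e| = 2.
Proof. by rewrite inE => /andP[/edgesP[]]. Qed.

Lemma tube_cover_disjoint e b r : e \in singular_edges F ->
  r \in faces (N (tube_part b)) ->
  ~~ [disjoint e & r] -> e \in middle_circle N.
Proof.
move=> e_sing /facesP[t tb rt] er; apply: (cut_one_circle cutF) => //.
apply: contra er => /(fun h => disjointWr _ h); apply.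
apply: subset_trans rt _; apply: bigcup_max (subxx t).
by rewrite -/tube in_tube; apply/existsP; exists b.
Qed.

Lemma singular_tube e b : e \in singular_edges F ->
  e \in faces (N (tube_part b)) ->
  e \in middle_circle N.
Proof.
move=> e_sing eb; apply: (tube_cover_disjoint e_sing eb).
by rewrite -setI_eq0 setIid; apply/eqP/card2_neq0/singular_card.
Qed.

Lemma middle_singular e : e \in middle_circle N -> e \in singular_edges F.
Proof.
case/(middle_circleP true) => e2 /facesP[t tt et] /facesP[d dM ed].
exact: (singular_edge e2 (@tube_thin true t tt) (middle_double dM)).
Qed.

Lemma middle_not_rest e : e \in middle_circle N -> e \notin faces rest.
Proof.
case/(middle_circleP true) => e2 _ eM;
  apply/negP=> /rest_neck/(_ eM)[b [_ /cap_middle_apart]].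
by move/(_ eM)/(card2_neq0 e2).
Qed.

(** A singular edge of [F'] has a surviving double triangle; if its thin triangle is in a cap, the
    edge is on an end circle and a tube triangle takes over in [F]. Conversely, a singular edge of
    [F] off the middle circle avoids the tube, so its thin triangle survives, and its double
    triangle is not in the disk because the rest meets the neck only along the tube. *)
Lemma singular_edges_cut : singular_edges F' = singular_edges F :\:
  middle_circle N.
Proof.
apply/setP=> e; rewrite in_setD; apply/idP/andP.
  rewrite inE => /andP[/edgesP[e2 [t tF' et]] /edgesP[_ [d dF' ed]]].
  have [dF d_rest] : d \in Defs.double F /\ d \in rest by apply/andP;
    rewrite -rest_double.
  have e_rest := face_mem d_rest ed.
  have -> : e \notin middle_circle N by apply/negP=> /middle_not_rest;
    rewrite e_rest.
  split=> //; have /thin'P[|[b tb]] := tF'.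
    by rewrite rest_thin => /andP[tF _]; apply: (singular_edge e2 tF dF).
  have [b' [/facesP[u ub' eu] _]] := rest_neck e_rest (face_mem tb et).
  exact: (singular_edge e2 (tube_thin ub') dF).
case=> e_mid e_sing; move: (e_sing);
  rewrite inE => /andP[/edgesP[e2 [t tF et]] /edgesP[_ [d dF ed]]].
have no_tube b : e \notin faces (N (tube_part b)).
  by apply: contra e_mid; apply: singular_tube.
have t_rest : t \in thin F :\: tube.
  have [//|[b tb]] := thinP tF.
  by have := no_tube b; rewrite (face_mem tb et).
apply: (@singular_edge _ _ e t d) => //; first by apply/thin'P; left.
rewrite (cut_double cutF) inE dF andbT; apply/negP=> dM.
have [b [eb _]] := rest_neck (face_mem (rest_thin_mem t_rest) et) (face_mem dM
  ed).
by have := no_tube b; rewrite eb.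
Qed.

Lemma rest_singular e : e \in faces rest ->
  (e \in singular_edges F') = (e \in singular_edges F).
Proof.
move=> e_rest; rewrite singular_edges_cut in_setD.
have -> : e \notin middle_circle N by apply/negP=> /middle_not_rest;
  rewrite e_rest.
by [].
Qed.

Lemma singular'_rest e : e \in singular_edges F' -> e \in faces rest.
Proof.
rewrite inE => /andP[_ /edgesP[_ [d]]].
by rewrite rest_double => /andP[_]; apply: face_mem.
Qed.

(** Such an edge lies in the rest; on the neck it would lie on the tube, hence on the middle circle,
    which has been removed. *)
Lemma singular'_apart e l : e \in singular_edges F' -> e \notin faces (N l).
Proof.
move=> e_sing; apply/negP=> el; have e_rest := singular'_rest e_sing.
have [b [eb _]] := rest_neck e_rest el; move: e_sing.
rewrite singular_edges_cut in_setD => /andP[e_mid e_sing].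
by rewrite (singular_tube e_sing eb) in e_mid.
Qed.

(** By [rest_neck] a triangle of the rest lying in a cap would be a face of a tube triangle, hence
    equal to it, but the tube is not in the rest. *)
Lemma rest_not_cap b t : t \in rest -> t \notin N (cap_part b).
Proof.
move=> t_rest; apply/negP=> tb.
have [b' [/facesP[u ub' tu] _]] := rest_neck (mem_faces t_rest) (mem_faces tb).
have tuE : t = u.
  by apply/eqP; rewrite eqEcard tu (card_tube ub') (card_rest t_rest).
move: t_rest; rewrite in_setD in_setU in_tube negb_or =>
  /andP[/andP[/existsP[]]].
by exists b'; rewrite tuE.
Qed.

Lemma rest_not_tube b t : t \in rest -> t \notin N (tube_part b).
Proof.
rewrite in_setD in_setU in_tube !negb_or => /andP[/andP[t_tube _] _].
by apply: contra t_tube => tb; apply/existsP; exists b.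
Qed.

(** Together with a triangle of the other half, two distinct ones would make three thin triangles at
    one edge. *)
Lemma tube_edge_unique b e t t' : e \in middle_circle N ->
  t \in N (tube_part b) -> t' \in N (tube_part b) -> e \subset t ->
    e \subset t' -> t = t'.
Proof.
move=> e_mid tb t'b et et'; apply/eqP/negPn/negP=> tt'.
have /(middle_circleP (~~ b))[e2 /facesP[u ub eu] _] := e_mid.
have := foam_edges foamF (e := e).
have eF : e \in edges (triangles F).
  by apply/edgesP; split=> //; exists t; rewrite // inE (tube_thin tb).
move=> /(_ eF); set T := [set _ in thin F | _].
have : [set t; t'; u] \subset T.
  apply/subsetP=> x; rewrite !inE => /orP[/orP[]|] /eqP->.
  - by rewrite (tube_thin tb).
  - by rewrite (tube_thin t'b).
  - by rewrite (tube_thin ub).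
move/subset_leq_card; rewrite setUC cardsU1 cards2 !inE tt'.
have [/negPf ut /negPf ut'] : u != t /\ u != t'.
  by split; apply: contraTneq ub => ->; apply: tubes_disjoint.
by rewrite ut ut' /= => T3 /or3P[] /eqP[] cT; rewrite cT in T3.
Qed.

(** * Transport of colorings across the cut *)

Lemma cardI_edge t t' : #|t| = 3 -> #|t'| = 3 -> t != t' ->
  (2 <= #|t :&: t'|)%N ->
  #|t :&: t'| = 2.
Proof.
move=> t3 t'3 tt' I2; apply/eqP; rewrite eqn_leq I2 andbT -ltnS -[ltnRHS]t3.
apply: proper_card; rewrite properEneq subsetIl andbT;
  apply: contraNneq tt' => I_t.
by rewrite eqEcard t3 t'3 andbT -I_t subsetIr.
Qed.

(** Linkedness of the half tube is applied to [k] itself: an edge between two distinct triangles of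
    one half is regular, because a singular one would be on the middle circle, where the triangle is
    unique. *)
Lemma tube_color k b t t' : thin_coloring F k ->
  t \in N (tube_part b) -> t' \in N (tube_part b) -> k t = k t'.
Proof.
move=> k_col tb t'b.
have linkb : linked 2 (faces (N (tube_part b)) :&: faces (N (tube_part b))).
  by case: b {tb t'b}; apply: (neck_linked neckN); vm_compute.
rewrite setIid in linkb.
have in_tube3 u : u \in faces (N (tube_part b)) -> #|u| = 3 ->
  u \in N (tube_part b).
  case/facesP=> v vb uv u3; suff -> : u = v by [].
  by apply/eqP; rewrite eqEcard uv u3 (card_tube vb).
apply: linkb; rewrite ?mem_faces ?(card_tube (b := b)) // => {t t' tb t'b}.
move=> t t' + + t3 t'3 I2 => /in_tube3 /(_ t3) tb /in_tube3 /(_ t'3) t'b.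
have [->//|tt'] := eqVneq t t'.
have e2 := cardI_edge t3 t'3 tt' I2.
apply/eqP; rewrite (k_col (t :&: t')) ?subsetIl ?subsetIr ?(tube_thin (b :=
  b)) //.
apply: contra tt' => e_sing; apply/eqP.
apply: (tube_edge_unique _ tb t'b (subsetIl _ _) (subsetIr _ _)).
exact: singular_tube e_sing (face_mem tb (subsetIl _ _)).
Qed.

Lemma cap_color k b t t' : thin_coloring F' k ->
  t \in N (cap_part b) -> t' \in N (cap_part b) -> k t = k t'.
Proof.
move=> k_col tb t'b.
have linkb : linked 2 (faces (N (cap_part b)) :&: faces (N (cap_part b))).
  by case: b {tb t'b}; apply: (neck_linked neckN); vm_compute.
rewrite setIid in linkb.
have in_cap3 u : u \in faces (N (cap_part b)) -> #|u| = 3 ->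
  u \in N (cap_part b).
  case/facesP=> v vb uv u3; suff -> : u = v by [].
  by apply/eqP; rewrite eqEcard uv u3 (card_cap vb).
apply: linkb; rewrite ?mem_faces ?(card_cap (b := b)) // => {t t' tb t'b}.
move=> t t' + + t3 t'3 I2 => /in_cap3 /(_ t3) tb /in_cap3 /(_ t'3) t'b.
have [->//|tt'] := eqVneq t t'.
have e2 := cardI_edge t3 t'3 tt' I2.
apply/eqP; rewrite (k_col (t :&: t')) ?subsetIl ?subsetIr ?(cap_thin (b :=
  b)) //.
apply: contraL (face_mem tb (subsetIl _ t')) => e_sing.
exact: singular'_apart.
Qed.

Lemma tube_neq0 b : exists t, t \in N (tube_part b).
Proof.
have [e e_mid] := middle_circle_neq0 neckN.
by have /(middle_circleP b)[_ /facesP[t tb _] _] := e_mid; exists t.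
Qed.

Lemma tube_colors k t t' : thin_coloring F k ->
  t \in N TopTube -> t' \in N BottomTube -> k t != k t'.
Proof.
move=> k_col tt t'b; have [e e_mid] := middle_circle_neq0 neckN.
have /(middle_circleP true)[e2 /facesP[u ut eu] _] := e_mid.
have /(middle_circleP false)[_ /facesP[u' ub eu'] _] := e_mid.
rewrite (tube_color (b := true) k_col tt ut) (tube_color (b :=
  false) k_col t'b ub).
rewrite (k_col e) ?(tube_thin (b := true) ut) ?(tube_thin (b := false) ub) //.
  by rewrite middle_singular.
by apply: contraTneq ub => <-; apply: (tubes_disjoint (b := true)).
Qed.

(** Each cap takes the color of the half tube that it closes. A relation serves for both directions
    of the correspondence. *)
Definition matching k k' := {in thin F :\: tube, k =1 k'} /\
  forall b t t', t \in N (tube_part b) -> t' \in N (cap_part b) -> k t = k' t'.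

Hypothesis caps_neq0 : forall b, exists t, t \in N (cap_part b).

Lemma rest_face_cap b e : #|e| = 2 -> e \in faces rest ->
  e \in faces (N (cap_part b)) -> e \in faces (N (tube_part b)).
Proof.
move=> e2 e_rest eb; have [b' [eb' eb'c]] := rest_neck e_rest eb.
have [<-//|bb'] := eqVneq b' b.
case: (card2_neq0 e2); apply: (caps_apart eb).
by move: bb' eb'c; case: b {eb}; case: b' {eb'}.
Qed.

Lemma rest_face_tube b e : #|e| = 2 -> e \in faces rest ->
  e \in faces (N (tube_part b)) -> e \in faces (N (cap_part b)).
Proof.
move=> e2 e_rest eb; have [b' [eb' eb'c]] := rest_neck e_rest eb.
have [<-//|bb'] := eqVneq b' b.
case: (card2_neq0 e2); apply: (cap_tube_apart eb'c).
by move: bb' eb; case: b; case: b' {eb' eb'c}.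
Qed.

Lemma rest_cap_color k k' e b t t' : thin_coloring F k -> matching k k' ->
  #|e| = 2 ->
  t \in thin F :\: tube -> t' \in N (cap_part b) -> e \subset t ->
    e \subset t' ->
  k' t = k' t' /\ e \notin singular_edges F'.
Proof.
move=> k_col [kk' kk'b] e2 t_rest t'b et et'.
have e_rest := face_mem (rest_thin_mem t_rest) et.
have e_reg : e \notin singular_edges F'.
  by apply: contraL (face_mem t'b et'); apply: singular'_apart.
have /facesP[u ub eu] := rest_face_cap e2 e_rest (face_mem t'b et').
split=> //; rewrite -(kk'b _ _ _ ub t'b) -kk' //; apply/eqP.
move: (t_rest); rewrite rest_thin => /andP[tF tR].
rewrite (k_col e) ?(tube_thin ub) // -?rest_singular //.
by apply: contraNneq (rest_not_tube b tR) => ->.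
Qed.

(** An edge between the rest and a cap also borders a tube triangle of the same end, whose color the
    cap has; all other pairs are old or inside a single cap. *)
Lemma thin_coloring_cut k k' : thin_coloring F k -> matching k k' ->
  thin_coloring F' k'.
Proof.
move=> k_col kk' e t t' e2 tF t'F et et' tt'.
have [kk'r kk'b] := kk'.
have [tr|[b tb]] := thin'P _ tF; have [t'r|[b' t'b]] := thin'P _ t'F.
- rewrite -!kk'r // rest_singular; last exact: face_mem (rest_thin_mem tr) et.
  by move: tr t'r; rewrite !rest_thin => /andP[? _] /andP[? _]; apply: k_col.
- by have [-> ->] := rest_cap_color k_col kk' e2 tr t'b et et'; rewrite eqxx.
- by have [-> ->] := rest_cap_color k_col kk' e2 t'r tb et' et; rewrite eqxx.
have bb' : b' = b.
  apply/eqP/negPn/negP=> bb'; case: (card2_neq0 e2).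
  apply: (caps_apart (face_mem tb et)).
  by move: bb' (face_mem t'b et'); case: b {tb}; case: b' {t'b}.
have [u ub] := tube_neq0 b; rewrite bb' in t'b.
rewrite -(kk'b _ _ _ ub tb) -(kk'b _ _ _ ub t'b) eqxx; apply/esym.
by apply: contraL (face_mem tb et); apply: singular'_apart.
Qed.

Lemma rest_tube_color k k' e b t t' : thin_coloring F' k' -> matching k k' ->
  #|e| = 2 ->
  t \in thin F :\: tube -> t' \in N (tube_part b) -> e \subset t ->
    e \subset t' ->
  k t = k t' /\ e \notin singular_edges F.
Proof.
move=> k'_col [kk' kk'b] e2 t_rest t'b et et'.
have e_rest := face_mem (rest_thin_mem t_rest) et.
have eb := rest_face_tube e2 e_rest (face_mem t'b et').
have e_reg : e \notin singular_edges F'.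
  by apply: contraL eb; apply: singular'_apart.
have /facesP[u ub eu] := eb.
split; last by rewrite -rest_singular.
rewrite (kk'b _ _ _ t'b ub) kk' //; apply/eqP.
rewrite (k'_col e) ?(cap_thin ub) //; first by apply/thin'P; left.
by apply: contraNneq (rest_not_cap b (rest_thin_mem t_rest)) => ->.
Qed.

(** The condition on the caps enters for two triangles from different halves: these share only edges
    of the middle circle, where the colors must differ. *)
Lemma thin_coloring_glue k k' : thin_coloring F' k' -> matching k k' ->
    (forall t t', t \in N TopCap -> t' \in N BottomCap -> k' t != k' t') ->
  thin_coloring F k.
Proof.
move=> k'_col kk' k'_caps e t t' e2 tF t'F et et' tt'.
have [kk'r kk'b] := kk'.
have [tr|[b tb]] := thinP tF; have [t'r|[b' t'b]] := thinP t'F.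
- rewrite !kk'r // -rest_singular; last exact: face_mem (rest_thin_mem tr) et.
  by apply: k'_col => //; apply/thin'P; left.
- by have [-> ->] := rest_tube_color k'_col kk' e2 tr t'b et et'; rewrite eqxx.
- by have [-> ->] := rest_tube_color k'_col kk' e2 t'r tb et' et; rewrite eqxx.
have [u ub] := caps_neq0 b; have [u' ub'] := caps_neq0 b'.
rewrite (kk'b _ _ _ tb ub) (kk'b _ _ _ t'b ub').
have [bb'|bb'] := eqVneq b' b.
  rewrite bb' in t'b ub'; rewrite (cap_color k'_col ub ub') eqxx.
  apply/esym; apply: contra tt' => e_sing; apply/eqP.
  exact: tube_edge_unique (singular_tube e_sing (face_mem tb et)) tb t'b et et'.
have -> : (k' u == k' u') = false.
  by apply/negbTE; move: bb' ub ub'; case: b {tb};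
    case: b' {t'b} => // _ ub ub';
    [|rewrite eq_sym]; apply: k'_caps.
apply/esym/negbTE; rewrite negbK; apply: middle_singular;
  apply/(middle_circleP b).
have eb := face_mem tb et; split=> //; rewrite -(tube_middle eb).
by move: bb' (face_mem t'b et'); case: b {tb ub eb}; case: b' {t'b ub'}.
Qed.

(** * Euler characteristics and dots *)

Lemma rest_faces_neck b r : r != set0 -> r \in faces rest ->
  (r \in faces (N (cap_part b))) = (r \in faces (N MiddleDisk :|:
    N (tube_part b))).
Proof.
move=> r0 r_rest; rewrite facesU in_setU; apply/idP/orP => [rb|].
  have [b' [rb' rb'c]] := rest_neck r_rest rb.
  have [<-|bb'] := eqVneq b' b; first by right.
  case/eqP: r0; apply: (caps_apart rb).
  by move: bb' rb'c; case: b {rb}; case: b' {rb'}.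
case=> rx; have [b' [rb' rb'c]] := rest_neck r_rest rx.
  by case/eqP: r0; apply: cap_middle_apart rb'c rx.
have [<-//|bb'] := eqVneq b' b.
case/eqP: r0; apply: (cap_tube_apart rb'c).
by move: bb' rx; case: b; case: b' {rb' rb'c}.
Qed.

Lemma rest_faces_caps r : r \in faces rest ->
  (r \in faces tube) = (r \in faces caps).
Proof.
move=> r_rest; rewrite !facesU !in_setU; apply/orP/orP => -[] rx;
  by have [[] [? ?]] := rest_neck r_rest rx; [left|right].
Qed.

(** Here and in the next three lemmas the value is one minus the Euler characteristic: 0 for a disk,
    1 for an annulus, -1 for two disks. *)
Lemma alt_sum_cap b : alt_sum (faces (N (cap_part b))) = 0.
Proof. by rewrite -[faces _]setIid (neck_alt_sum neckN); case: b; vm_compute.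
Qed.

Lemma alt_sum_half_neck b : alt_sum (faces (N MiddleDisk :|:
  N (tube_part b))) = 0.
Proof.
rewrite facesU alt_sumU -{1}[faces (N MiddleDisk)]setIid -{1}[faces (N
  (tube_part _))]setIid.
by rewrite !(neck_alt_sum neckN); case: b; vm_compute.
Qed.

Lemma alt_sum_tube : alt_sum (faces tube) = 1.
Proof.
rewrite facesU alt_sumU -{1}[faces (N TopTube)]setIid -{1}[faces (N
  BottomTube)]setIid.
by rewrite !(neck_alt_sum neckN); vm_compute.
Qed.

Lemma alt_sum_caps : alt_sum (faces caps) = - 1.
Proof.
rewrite facesU alt_sumU -{1}[faces (N TopCap)]setIid -{1}[faces (N
  BottomCap)]setIid.
by rewrite !(neck_alt_sum neckN); vm_compute.
Qed.

Lemma faces_mono (S S' : {set {set V}}) r : S \subset S' -> r \in faces S ->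
  r \in faces S'.
Proof. by move=> /subsetP SS' /facesP[t /SS' tS' rt]; apply/facesP; exists t.
Qed.

Lemma set_neq0 (S : {set {set V}}) t : t \in S -> S != set0.
Proof. by move=> tS; apply/set0Pn; exists t. Qed.

Lemma mem_tube b t : t \in N (tube_part b) -> t \in tube.
Proof. by move=> tb; rewrite in_tube; apply/existsP; exists b. Qed.

Lemma mem_caps b t : t \in N (cap_part b) -> t \in caps.
Proof. by move=> tb; rewrite in_caps; apply/existsP; exists b. Qed.

Lemma thin_tube : thin F = thin F :\: tube :|: tube.
Proof.
apply/setP=> t; rewrite in_setU in_setD; have [tt|] := boolP (t \in tube).
  by rewrite orbT (subsetP (cut_tube_thin cutF)).
by rewrite orbF.
Qed.

Lemma euler_thin_cut : euler (thin F') = euler (thin F) + 2.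
Proof.
have := @euler_replace V (thin F :\: tube) tube caps.
rewrite alt_sum_tube alt_sum_caps -thin_tube -(cut_thin cutF) => eulE.
have [] : euler (thin F) + 1 = euler (thin F') + -1.
  apply: eulE => [t tF|t tF|||r _ rA].
  - by apply: card_triangle; rewrite !inE tF.
  - by apply: card_triangle; rewrite !inE tF !orbT.
  - by have [t tb] := tube_neq0 true; apply: set_neq0 (mem_tube tb).
  - by have [t tb] := caps_neq0 true; apply: set_neq0 (mem_caps tb).
  apply: rest_faces_caps; apply: faces_mono rA; apply/subsetP=> t.
  exact: rest_thin_mem.
by move/eqP; rewrite -subr_eq opprK => /eqP <-; rewrite -addrA.
Qed.

Lemma neq_negb b b' : b' != b -> b' = ~~ b.
Proof. by case: b; case: b'. Qed.

(** A disk is exchanged for a disk with the same boundary: the middle disk together with the half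
    tube of color [i], for the cap at that end. *)
Lemma euler_surface_cut (c : {ffun thin_facet F ->
  color}) (c' : {ffun thin_facet F' -> color})
    i b : matching (color_at c) (color_at c') ->
    (forall t, t \in N (tube_part b) -> color_at c t = i) ->
    (forall t, t \in N (tube_part (~~ b)) -> color_at c t != i) ->
  euler (surface c i) = euler (surface c' i).
Proof.
move=> [cc' cc'b] cb cNb.
(* The part of the one-colored surface that both foams have in common. *)
pose A := Defs.double F' :|: [set t in thin F :\: tube | color_at c t == i].
have A_rest : A \subset rest.
  apply/subsetP=> t /setUP[|]; first by rewrite rest_double => /andP[].
  by rewrite inE => /andP[/rest_thin_mem].
have surfF : surface c i = A :|: (N MiddleDisk :|: N (tube_part b)).
  rewrite surfaceE; apply/setP=> t; apply/setUP/setUP.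
    case=> [tF|]; first have [tM|tM] := boolP (t \in N MiddleDisk).
    - by right; rewrite inE tM.
    - by left; rewrite inE (cut_double cutF) in_setD tM tF.
    rewrite inE => /andP[/thinP[tr|[b' tb']] /eqP tc].
      by left; rewrite in_setU [X in _ || X]inE tr tc eqxx orbT.
    right; rewrite inE; have [<-|bb'] := eqVneq b' b; first by rewrite tb' orbT.
    by move: bb' cNb tb'; case: b {cb}; case: b' => //= _ cNb /cNb;
      rewrite tc eqxx.
  case=> /setUP[tA|tA].
  - by left; move: tA; rewrite rest_double => /andP[].
  - by right; move: tA; rewrite !inE => /andP[/andP[_ ->] ->].
  - by left; apply: middle_double.
  - by right; rewrite inE (tube_thin tA) cb //= eqxx.
have surfF' : surface c' i = A :|: N (cap_part b).
  rewrite surfaceE; apply/setP=> t; apply/setUP/setUP.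
    case=> [tF|]; first by left; rewrite inE tF.
    rewrite inE => /andP[/thin'P[tr|[b' tb']] /eqP tc].
      by left; rewrite in_setU [X in _ || X]inE tr cc' // tc eqxx orbT.
    right; have [<-//|bb'] := eqVneq b' b.
    have [u ub] := tube_neq0 b'.
    have : color_at c u != i by apply: cNb; rewrite -(neq_negb bb').
    by rewrite (cc'b _ _ _ ub tb') tc eqxx.
  case=> [/setUP[tA|]|tb].
  - by left.
  - rewrite inE => /andP[tr /eqP <-]; right; rewrite inE cc' // eqxx andbT.
    by apply/thin'P; left.
  - right; rewrite inE (cap_thin tb); have [u ub] := tube_neq0 b.
    by rewrite -(cc'b _ _ _ ub tb) cb //= eqxx.
rewrite surfF surfF'.
have := @euler_replace V A (N MiddleDisk :|: N (tube_part b)) (N (cap_part b)).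
rewrite alt_sum_half_neck alt_sum_cap !addr0; apply => [t|t|||r r0 rA].
- rewrite -surfF => tF; apply: card_triangle; rewrite in_setU; apply/orP; left.
  move: tF; rewrite surfaceE in_setU => /orP[tF|]; first by rewrite inE tF orbT.
  by rewrite inE => /andP[tF _]; rewrite inE tF.
- rewrite -surfF' => tF; apply: card_triangle; rewrite in_setU; apply/orP;
  right.
  move: tF; rewrite surfaceE in_setU => /orP[tF|]; first by rewrite inE tF orbT.
  by rewrite inE => /andP[tF _]; rewrite inE tF.
- by have [t tb] := tube_neq0 b; apply: (@set_neq0 _ t); rewrite inE tb orbT.
- by have [t tb] := caps_neq0 b; apply: set_neq0 tb.
by rewrite rest_faces_neck //; apply: faces_mono rA.
Qed.

Lemma dots_of_color_cut (c : {ffun thin_facet F ->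
  color}) (c' : {ffun thin_facet F' -> color}) i :
  matching (color_at c) (color_at c') -> dots_of_color c i = dots_of_color c' i.
Proof.
move=> [cc' cc'b]; rewrite !dots_of_colorE.
rewrite (bigID (fun t : {set V} => t \in tube)) /= big1 ?add0n =>
  [|t /andP[_ tt]]; last exact: (cut_tube_dots cutF).
rewrite [RHS](bigID (fun t : {set V} =>
  t \in caps)) /= [X in _ = (X + _)%N]big1 ?add0n => [|t /andP[_ tt]];
    last exact: (cut_cap_dots cutF).
have restE t : (t \in thin F') && (t \notin caps) = (t \in thin F) &&
  (t \notin tube).
  rewrite -[RHS]andbC -in_setD; apply/andP/idP => [[/thin'P[//|[b tb]]]|tr].
    by rewrite (mem_caps tb).
  split; first by apply/thin'P; left.
  rewrite in_caps; apply/existsPn=> b; exact: rest_not_cap (rest_thin_mem tr).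
apply: eq_big => [t|t].
  rewrite andbAC -[RHS]andbAC restE; apply: andb_id2l => /andP[tF tt].
  by rewrite cc' // inE tt tF.
rewrite andbAC => /andP[/andP[tF tt] _]; apply/esym/(cut_dots cutF).
by apply: rest_thin_mem; rewrite inE tt tF.
Qed.

(** * Singular circles and their signs *)

Lemma singular'_triangle e t : e \in singular_edges F' -> e \subset t ->
  [/\ (t \in thin F) = (t \in thin F'),
    (t \in Defs.double F) = (t \in Defs.double F')
    & t \in triangles F -> t \in rest].
Proof.
move=> e_sing et; have no_part l : t \notin N l.
  by apply: contra (singular'_apart l e_sing) => /face_mem; apply.
have t_tube : t \notin tube by rewrite in_tube; apply/existsPn=> b;
  apply: no_part.
have t_caps : t \notin caps by rewrite in_caps; apply/existsPn=> b;
  apply: no_part.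
split; last by move=> tF; rewrite /rest in_setD in_setU negb_or t_tube no_part.
  by rewrite (cut_thin cutF) in_setU in_setD t_tube (negPf t_caps) orbF.
by rewrite (cut_double cutF) in_setD no_part.
Qed.

Section MatchingColorings.
Variables (c : {ffun thin_facet F -> color}) (c' : {ffun thin_facet F' ->
  color}).
Hypothesis cc' : matching (color_at c) (color_at c').

Lemma edge_positive_cut e : e \in singular_edges F' ->
  edge_positive pos c e = edge_positive pos c' e.
Proof.
move=> e_sing; rewrite !edge_positiveE.
apply: eq_existsb => u; apply: eq_existsb => v; apply: eq_existsb => a.
apply: eq_existsb => b; apply: eq_existsb => d.
have [aE _ a_rest] := singular'_triangle e_sing (subsetUr [set a] e).
have [bE _ _] := singular'_triangle e_sing (subsetUr [set b] e).
have [_ dE _] := singular'_triangle e_sing (subsetUr [set d] e).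
rewrite -aE -bE -dE; have [aF|] := boolP (a |: e \in thin F);
  last by rewrite andbF.
have aR : a |: e \in rest by apply: a_rest; rewrite inE aF.
by rewrite (cut_orient cutF) // (proj1 cc') // rest_thin aF.
Qed.

Let linked_edges (G : foam V) : rel {set V} := fun e e' =>
  [&& e \in singular_edges G, e' \in singular_edges G & e :&: e' != set0].

Lemma linked_edges_sym (G : foam V) : connect_sym (linked_edges G).
Proof. by apply: sym_connect_sym => e e'; rewrite /linked_edges andbCA setIC.
Qed.

(** By [cut_one_circle] no singular edge outside the middle circle touches it, so the component of
    [e] stays inside; linkedness of the circle shows that the component is all of it. *)
Lemma singular_circle_middle e : e \in middle_circle N ->
  singular_circle F e = middle_circle N.
Proof.
move=> e_mid; apply/setP=> e'; rewrite inE; apply/idP/idP=> [ee'|e'_mid].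
  have mid_closed : closed (linked_edges F) (mem (middle_circle N)).
    apply: (intro_closed (linked_edges_sym F)) =>
      e1 e2 /and3P[_ e2_sing e12] /= e1_mid.
    have /(middle_circleP true)[_ e1t _] := e1_mid.
    by apply: (tube_cover_disjoint e2_sing e1t); rewrite -setI_eq0 setIC.
  by rewrite -(closed_connect mid_closed ee').
have link1 : linked 1 (faces (N TopTube) :&: faces (N MiddleDisk)).
  by apply: (neck_linked neckN); vm_compute.
have mid_face x : x \in middle_circle N ->
    x \in faces (N TopTube) :&: faces (N MiddleDisk) /\ #|x| = 2.
  by case/(middle_circleP true)=> x2 xt xM; rewrite inE xt xM.
have [eC e2] := mid_face _ e_mid; have [e'C e'2] := mid_face _ e'_mid.
(* The two-valued function is reachability from [e]. *)
rewrite -(link1 (connect (linked_edges F) e) _ e e') ?connect0 // =>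
  {e' e'_mid e'C e'2}.
move=> e1 e2' e1C e2C e1_2 e2_2 e12.
have face_mid x : x \in faces (N TopTube) :&: faces (N MiddleDisk) ->
  #|x| = 2 ->
    x \in singular_edges F.
  by rewrite inE => /andP[xt xM] x2; apply: middle_singular;
    apply/(middle_circleP true).
apply: same_connect_r; first exact: linked_edges_sym.
apply: connect1; rewrite /linked_edges !face_mid //=.
by rewrite -cards_eq0 -lt0n.
Qed.

(** A chain of singular edges of [F] starting off the middle circle cannot enter it: an edge
    touching the middle circle already belongs to it. *)
Lemma singular_circle_out e : e \in singular_edges F' ->
  singular_circle F e = singular_circle F' e.
Proof.
move=> e_sing; apply/setP=> e'; rewrite !inE; apply/idP/idP; last first.
  apply: connect_sub => e1 e2 /and3P[]; rewrite singular_edges_cut !in_setD.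
  by case/andP=> _ e1_sing /andP[_ e2_sing] e12; apply: connect1;
    rewrite e1_sing e2_sing.
case/connectP=> p; elim: p e e_sing => /= [|e2 p IH] e e_sing;
  first by move=> _ ->; apply: connect0.
case/andP=> /and3P[_ e2_sing ee2] e2p e'E.
have e2_sing' : e2 \in singular_edges F'.
  rewrite singular_edges_cut in_setD e2_sing andbT;
    apply/negP=> /(middle_circleP true)[_ e2t _].
  move: (e_sing); rewrite singular_edges_cut in_setD => /andP[e_mid e_singF].
  case/negP: e_mid; apply: (tube_cover_disjoint e_singF e2t).
  by rewrite -setI_eq0.
apply: connect_trans (IH _ e2_sing' e2p e'E).
by apply: connect1; rewrite e_sing e2_sing' ee2.
Qed.

Lemma singular_circles_cut : singular_circles F = middle_circle N |:
  singular_circles F'.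
Proof.
apply/setP=> C; rewrite in_setU1;
  apply/imsetP/orP=> [[e e_sing ->]|[/eqP->|/imsetP[e e_sing ->]]].
- have [e_mid|e_mid] := boolP (e \in middle_circle N); [left|right].
    by rewrite singular_circle_middle.
  have e_sing' : e \in singular_edges F' by rewrite singular_edges_cut in_setD
    e_mid.
  by rewrite singular_circle_out // imset_f.
- have [e e_mid] := middle_circle_neq0 neckN.
  by exists e; [apply: middle_singular | rewrite singular_circle_middle].
exists e; last by rewrite singular_circle_out.
by move: e_sing; rewrite singular_edges_cut in_setD => /andP[].
Qed.

Lemma singular_circle_sub (G : foam V) C : C \in singular_circles G ->
  C \subset singular_edges G.
Proof.
case/imsetP=> e e_sing ->; apply/subsetP=> e'; rewrite inE => ee'.
have sing_closed : closed (linked_edges G) (mem (singular_edges G)).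
  by move=> e1 e2 /and3P[/= -> ->].
by rewrite -(closed_connect sing_closed ee').
Qed.

Lemma middle_not_circle : middle_circle N \notin singular_circles F'.
Proof.
apply/negP=> /singular_circle_sub/subsetP mid_sing; have [e e_mid] :=
  middle_circle_neq0 neckN.
by have := mid_sing e e_mid; rewrite singular_edges_cut in_setD e_mid.
Qed.

Lemma theta_plus_cut :
  theta_plus pos c = (circle_positive pos c (middle_circle N) + theta_plus pos
    c')%N.
Proof.
apply: (card_setU1_sat (P :=
  circle_positive pos c) singular_circles_cut middle_not_circle).
move=> C /singular_circle_sub/subsetP C_sing.
apply/forall_inP/forall_inP=> C_pos e eC.
  by rewrite -edge_positive_cut; [apply: C_pos | apply: C_sing].
by rewrite edge_positive_cut; [apply: C_pos | apply: C_sing].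
Qed.

End MatchingColorings.

Hypothesis positiveF : positive_when_top_is_1 pos F N.

(** If the top is colored 2, exchanging the colors gives a coloring to which the hypothesis applies,
    and an edge positive there is not positive for [c]. *)
Lemma circle_positive_middle (c : {ffun thin_facet F -> color}) t :
  is_coloring c -> t \in N TopTube ->
  circle_positive pos c (middle_circle N) = color_at c t.
Proof.
move=> c_col tt; have tF : t \in thin F := @tube_thin true t tt.
have top_positive (d : {ffun thin_facet F -> color}) :
    is_coloring d -> color_at d t -> circle_positive pos d (middle_circle N).
  move=> d_col dt; apply: (positiveF d_col) => f /set0Pn[u /setIP[uf ut]].
  have /is_coloringP d_col' := d_col.
  by rewrite -(color_atE _ uf) (tube_color (b := true) d_col' ut tt).
have [ct|ct] := boolP (color_at c t); first by apply: top_positive.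
have swap_col : thin_coloring F (fun u => ~~ color_at c u).
  move=> e u u' e2 uF u'F eu eu' uu'; have /is_coloringP c_col' := c_col.
  by rewrite -(c_col' e u u') //; case: (color_at c u); case: (color_at c u').
pose d := make_coloring F (fun u => ~~ color_at c u).
have dE : {in thin F, forall u, color_at d u = ~~ color_at c u} :=
  make_coloringK swap_col.
have d_pos : circle_positive pos d (middle_circle N).
  by apply: top_positive; [apply: make_coloring_is_coloring | rewrite dE].
(* Positivity of a circle demands all its edges, so one edge is enough to refute it. *)
apply/negbTE; have [e e_mid] := middle_circle_neq0 neckN.
apply/forall_inPn; exists e => //.
apply: edge_positive_swap foamF (middle_singular e_mid) _
  (forall_inP d_pos e e_mid).
by move=> u uF; rewrite dE // negbK.
Qed.

(** This and its mirror image make the correspondence of colorings one-to-one: each half tube is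
    read off a triangle of its cap, and vice versa. *)
Lemma matching_left k1 k2 k' : matching k1 k' -> matching k2 k' ->
  {in thin F, k1 =1 k2}.
Proof.
move=> [k1r k1b] [k2r k2b] t /thinP[tr|[b tb]]; first by rewrite k1r ?k2r.
by have [u ub] := caps_neq0 b; rewrite (k1b _ _ _ tb ub) (k2b _ _ _ tb ub).
Qed.

Lemma matching_right k k1 k2 : matching k k1 -> matching k k2 ->
  {in thin F', k1 =1 k2}.
Proof.
move=> [k1r k1b] [k2r k2b] t /thin'P[tr|[b tb]]; first by rewrite -k1r -?k2r.
by have [u ub] := tube_neq0 b; rewrite -(k1b _ _ _ ub tb) -(k2b _ _ _ ub tb).
Qed.

Lemma matching_eq k1 k1' k2 k2' : {in thin F, k1 =1 k2} ->
  {in thin F', k1' =1 k2'} ->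
  matching k1 k1' -> matching k2 k2'.
Proof.
move=> k12 k12' [k1r k1b]; split=> [t tr|b t t' tb t'b].
  rewrite -k12 -?k12' ?k1r //; first by apply/thin'P; left.
  by move: tr; rewrite in_setD => /andP[].
by rewrite -k12 ?(tube_thin tb) // -k12' ?(cap_thin t'b) // (k1b _ _ _ tb t'b).
Qed.

(** * The correspondence of colorings and the resulting identity *)

Variables top bottom : {set V}.
Hypotheses (topN : top \in N TopCap) (bottomN : bottom \in N BottomCap).

Let tops : exists t, t \in N TopTube := tube_neq0 true.
Let bottoms : exists t, t \in N BottomTube := tube_neq0 false.
Let tube_top := xchoose tops.
Let tube_bottom := xchoose bottoms.

(** One sample triangle per half tube suffices, as the color is constant on each half. *)
Definition cut_coloring (c : {ffun thin_facet F -> color}) :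
    {ffun thin_facet F' -> color} :=
  make_coloring F' (fun t => if t \in N TopCap then color_at c tube_top
    else if t \in N BottomCap then color_at c tube_bottom else color_at c t).

Definition glue_coloring (c' : {ffun thin_facet F' -> color}) :
    {ffun thin_facet F -> color} :=
  make_coloring F (fun t => if t \in N TopTube then color_at c' top
    else if t \in N BottomTube then color_at c' bottom else color_at c' t).

Lemma cut_coloringP c : is_coloring c ->
  is_coloring (cut_coloring c) /\ matching (color_at c) (color_at (cut_coloring
    c)).
Proof.
move=> /is_coloringP c_col; rewrite /cut_coloring; set k' := fun t => _.
have k'_match : matching (color_at c) k'.
  split=> [t /rest_thin_mem tr|b t t' tb t'b].
    by rewrite /k' (negPf (rest_not_cap true tr)) (negPf (rest_not_cap false
      tr)).
  rewrite /k'; case: b tb t'b => /= tb t'b.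
    by rewrite t'b; apply: (tube_color (b := true) c_col tb (xchooseP tops)).
  have -> : (t' \in N TopCap) = false.
    apply/negP=> t't; have := caps_apart (b :=
      true) (mem_faces t't) (mem_faces t'b).
    by move=> t'0; have := card_cap (b := true) t't; rewrite t'0 cards0.
  by rewrite t'b; apply: (tube_color (b := false) c_col tb (xchooseP bottoms)).
have k'_col := thin_coloring_cut c_col k'_match.
split; first exact: make_coloring_is_coloring.
by apply: matching_eq k'_match => // t tF; rewrite make_coloringK.
Qed.

Lemma glue_coloringP c' : is_coloring c' ->
  color_at c' top != color_at c' bottom ->
  is_coloring (glue_coloring c') /\ matching (color_at (glue_coloring c'))
    (color_at c').
Proof.
move=> /is_coloringP c'_col tb_neq; rewrite /glue_coloring; set k := fun t => _.
have k_match : matching k (color_at c').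
  split=> [t /rest_thin_mem tr|b t t' tb t'b].
    by rewrite /k (negPf (rest_not_tube true tr)) (negPf (rest_not_tube false
      tr)).
  rewrite /k; case: b tb t'b => /= tb t'b.
    by rewrite tb; apply: (cap_color (b := true) c'_col topN t'b).
  rewrite tb (negPf (tubes_disjoint (b := false) tb)).
  exact: (cap_color (b := false) c'_col bottomN t'b).
have k_col : thin_coloring F k.
  apply: (thin_coloring_glue c'_col k_match) => t t' tt t'b.
  rewrite (cap_color (b := true) c'_col tt topN).
  by rewrite (cap_color (b := false) c'_col t'b bottomN).
split; first exact: make_coloring_is_coloring.
by apply: matching_eq k_match => // t tF; rewrite make_coloringK.
Qed.

Lemma cut_coloring_caps c : is_coloring c ->
  color_at (cut_coloring c) top != color_at (cut_coloring c) bottom.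
Proof.
move=> c_col; have [_ [_ cb]] := cut_coloringP c_col;
  have /is_coloringP c_col' := c_col.
rewrite -(cb true _ _ (xchooseP tops) topN) -(cb false _ _ (xchooseP bottoms)
  bottomN).
exact: tube_colors (xchooseP tops) (xchooseP bottoms).
Qed.

Let evaluation_with_dot (c' : {ffun thin_facet F' -> color}) t :=
  @color_evaluation V (add_dot F' t) R pos c'.

Lemma color_evaluation_cut c : is_coloring c ->
  color_evaluation pos c = evaluation_with_dot (cut_coloring c) bottom
    - evaluation_with_dot (cut_coloring c) top.
Proof.
move=> c_col; have [c'_col cc'] := cut_coloringP c_col.
have /is_coloringP c_thin := c_col; have [_ cc'b] := cc'.
have [t tt] := tops; have [u ub] := bottoms.
have t_top : color_at c t = color_at (cut_coloring c) top :=
  cc'b true _ _ tt topN.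
have u_bottom : color_at c u = color_at (cut_coloring c) bottom :=
  cc'b false _ _ ub bottomN.
have tu := tube_colors c_thin tt ub.
(* The halves have different colors, so [i] is the color of exactly one of them, and that end is the
   one where disks are exchanged. *)
have euler_surf i : euler (surface c i) = euler (surface (cut_coloring c) i).
  have [ti|ti] := eqVneq (color_at c t) i.
    apply: (euler_surface_cut (b := true) cc') => v vN.
      by rewrite (tube_color (b := true) c_thin vN tt).
    by rewrite (tube_color (b := false) c_thin vN ub) -ti eq_sym.
  apply: (euler_surface_cut (b := false) cc') => v vN; last first.
    by rewrite (tube_color (b := true) c_thin vN tt).
  rewrite (tube_color (b := false) c_thin vN ub).
  by move: ti tu; case: (color_at c t); case: (color_at c u); case: i.
rewrite /evaluation_with_dot !color_evaluation_add_dot;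
  try exact: (@cap_thin true); try exact: (@cap_thin false).
have -> : color_evaluation pos c = eval_form x1 x2 p12 p21 (theta_plus pos c)
    (euler (surface c true)) (euler (surface c false)) (euler (thin F))
    (dots_of_color c true) (dots_of_color c false) by [].
rewrite !euler_surf !(dots_of_color_cut _ cc') euler_thin_cut (theta_plus_cut
  cc').
rewrite (circle_positive_middle c_col tt) -t_top -u_bottom.
(* With the top colored 1 the middle circle contributes a sign and the dot of color 1 is on the top
   disk; with the top colored 2 there is no sign and that dot is on the bottom disk. Both give
   bottom minus top. *)
move: tu; case: (color_at c t); case: (color_at c u) => //= _; rewrite ?addn0.
  by rewrite eval_form_theta (eval_form_dots _ _ x12_unit) opprB.
by rewrite add0n (eval_form_dots _ _ x12_unit).
Qed.

Lemma color_evaluation_same c' : color_at c' top = color_at c' bottom ->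
  evaluation_with_dot c' bottom - evaluation_with_dot c' top = 0.
Proof.
move=> tb; rewrite /evaluation_with_dot !color_evaluation_add_dot;
  try exact: (@cap_thin true); try exact: (@cap_thin false).
by rewrite tb subrr.
Qed.

Lemma evaluation_cut : evaluation F pos =
  evaluation (add_dot F' bottom) pos - evaluation (add_dot F' top) pos.
Proof.
transitivity (\sum_(c' : {ffun thin_facet F' -> color} | is_coloring c')
    (evaluation_with_dot c' bottom - evaluation_with_dot c' top));
      last by rewrite sumrB.
rewrite (bigID (fun c' =>
  color_at c' top != color_at c' bottom)) /= addrC big1 ?add0r; last first.
  by move=> c' /andP[_ /negPn/eqP]; apply: color_evaluation_same.
(* Either coloring of a matching pair determines the other, so the two constructions are mutually
   inverse between the colorings of [F] and those of [F'] with differently colored caps. *)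
rewrite (reindex_onto cut_coloring glue_coloring) /=; last first.
  move=> c' /andP[c'_col c'_tb]; have [g_col g_match] :=
    glue_coloringP c'_col c'_tb.
  have [_ cg_match] := cut_coloringP g_col.
  by apply: color_at_inj; apply: matching_right cg_match g_match.
apply: eq_big => [c|c c_col]; last exact: color_evaluation_cut.
apply/idP/idP=> [c_col|/andP[/andP[c'_col c'_tb] /eqP <-]]; last by have [] :=
  glue_coloringP c'_col c'_tb.
have [c'_col c_match] := cut_coloringP c_col.
have c'_tb := cut_coloring_caps c_col; rewrite c'_col c'_tb /=.
have [_ g_match] := glue_coloringP c'_col c'_tb.
by apply/eqP/color_at_inj; apply: matching_left g_match c_match.
Qed.

End NeckCut.

Theorem proposition4p5 (R : realType) (V : finType) (pos : V -> 'rV[R]_3)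
    (F F' : foam V) (N : neck_part -> {set {set V}}) (top bottom : {set V}) :
  is_foam F pos -> is_foam F' pos -> neck_cut pos F F' N ->
  positive_when_top_is_1 pos F N ->
  top \in N TopCap -> bottom \in N BottomCap ->
  let F1 := add_dot F' top in let F2 := add_dot F' bottom in
  evaluation F pos = evaluation F2 pos - evaluation F1 pos.
Proof.
move=> foamF foamF' cutF positiveF topN bottomN F1 F2.
apply: (evaluation_cut foamF cutF _ positiveF topN bottomN).
(* The dotted triangles witness that the caps are nonempty. *)
by case; [exists top | exists bottom].
Qed.
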